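(* Let $k$ be a field, $G$ an affine smooth algebraic group over $k$, and $S$ a $G$-algebra which is a UFD. Let $K$ be the integral closure of $k$ in $S$. Assume that $G(K)$ is dense in $K\otimes_k G$, that the character group $X(K\otimes_k G)$ is trivial, and that $S^\times\subset A:=S^G$. Then $A$ is a UFD.
   Context: A $G$-algebra is a commutative $k$-algebra $S$ with a $G$-action, i.e. with a $k[G]$-comodule structure $\omega:S\to S\otimes_k k[G]$ (the coaction) which is a $k$-algebra map; $S^G=\{s\in S\mid\omega(s)=s\otimes 1\}$. For a field $K$ and an affine algebraic $K$-group $H$, $X(H)$ is the group of $K$-homomorphisms $H\to\mathbb G_m$. $G(K)$ denotes the group of $K$-valued points of $G$; density is with respect to the Zariski topology. *)

(* Defs.v *)
From HB Require Import structures.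
From mathcomp Require Import all_boot all_order all_algebra.
From mathcomp Require Import boolp classical_sets.

Set Implicit Arguments.
Unset Strict Implicit.
Unset Printing Implicit Defensive.

Import GRing.Theory.
Local Open Scope ring_scope.
Local Open Scope quotient_scope.

(* Tensor product of two commutative algebras over a field: finite formal sums
   of pure tensors, modulo the congruence generated by the bilinearity
   relations. *)

Section TensorRelation.
Variables (k : fieldType) (A B : comAlgType k).
Implicit Types (s t : seq (A * B)).

Inductive tens_rel : seq (A * B) -> seq (A * B) -> Prop :=
| TensRefl s : tens_rel s s
| TensSym s t : tens_rel s t -> tens_rel t s
| TensTrans s t u : tens_rel s t -> tens_rel t u -> tens_rel s u
| TensCat s s' t t' :
    tens_rel s s' -> tens_rel t t' -> tens_rel (s ++ t) (s' ++ t')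
| TensCatC s t : tens_rel (s ++ t) (t ++ s)
| Tens0l b : tens_rel [:: (0, b)] [::]
| TensDl a a' b : tens_rel [:: (a + a', b)] [:: (a, b); (a', b)]
| TensDr a b b' : tens_rel [:: (a, b + b')] [:: (a, b); (a, b')]
| TensZ c a b : tens_rel [:: (c *: a, b)] [:: (a, c *: b)].

Definition tens_relb s t : bool := `[< tens_rel s t >].

Lemma tens_relb_refl : reflexive tens_relb.
Proof. by move=> s; apply/asboolP/TensRefl. Qed.

Lemma tens_relb_sym : symmetric tens_relb.
Proof. by move=> s t; apply/asboolP/asboolP => /TensSym. Qed.

Lemma tens_relb_trans : transitive tens_relb.
Proof.
by move=> t s u /asboolP st /asboolP tu; apply/asboolP/(TensTrans st tu).
Qed.

Canonical tens_equiv :=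
  EquivRel tens_relb tens_relb_refl tens_relb_sym tens_relb_trans.

Definition tensor : Type := {eq_quot tens_equiv}.

HB.instance Definition _ := Choice.on tensor.

Definition tens_class s : tensor := \pi_({eq_quot tens_equiv}) s.

Lemma tens_classP s t : tens_class s = tens_class t <-> tens_rel s t.
Proof. by split=> [/eqmodP/asboolP|/asboolP h] //; apply/eqmodP. Qed.

Lemma tens_ind (P : tensor -> Prop) :
  (forall s, P (tens_class s)) -> forall x, P x.
Proof. by move=> h x; rewrite -[x]reprK; apply: h. Qed.

Lemma tens_reprK x : tens_class (repr (x : {eq_quot tens_equiv})) = x.
Proof. exact: reprK. Qed.

Definition tens_sum (V : zmodType) (f : A -> B -> V) s : V :=
  \sum_(p <- s) f p.1 p.2.

Lemma tens_rel_sum (V : lmodType k) (f : A -> B -> V) :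
    (forall b, linear (f ^~ b)) -> (forall a, linear (f a)) ->
  forall s t, tens_rel s t -> tens_sum f s = tens_sum f t.
Proof.
move=> fl fr s t; rewrite /tens_sum.
elim=> {s t} //=.
- by move=> s t u _ -> _ ->.
- by move=> s s' t t' _ hs _ ht; rewrite !big_cat hs ht.
- by move=> s t; rewrite !big_cat /= addrC.
- move=> b; rewrite big_seq1 big_nil /=.
  have := fl b (-1) 0 0; rewrite scaler0 addr0 => ->.
  by rewrite scaleN1r addNr.
- move=> a a' b; rewrite !big_cons big_nil /= !addr0.
  by have := fl b 1 a a'; rewrite !scale1r.
- move=> a b b'; rewrite !big_cons big_nil /= !addr0.
  by have := fr a 1 b b'; rewrite !scale1r.
- have fl0 b : f 0 b = 0.
    have := fl b (-1) 0 0; rewrite scaler0 addr0 => ->.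
    by rewrite scaleN1r addNr.
  have fr0 a : f a 0 = 0.
    have := fr a (-1) 0 0; rewrite scaler0 addr0 => ->.
    by rewrite scaleN1r addNr.
  move=> c a b; rewrite !big_seq1 /=.
  have := fl b c a 0; have := fr a c b 0.
  by rewrite !addr0 fl0 fr0 !addr0 => -> ->.
Qed.

Definition tens_add (x y : tensor) := tens_class (repr x ++ repr y).
Definition tens_opp (x : tensor) :=
  tens_class [seq (- p.1, p.2) | p <- repr x].
Definition tens_scale (c : k) (x : tensor) :=
  tens_class [seq (c *: p.1, p.2) | p <- repr x].
Definition tens_mulseq s t := [seq (p.1 * q.1, p.2 * q.2) | p <- s, q <- t].
Definition tens_mul (x y : tensor) := tens_class (tens_mulseq (repr x) (repr y)).

Lemma tens_repr s : tens_rel (repr (tens_class s)) s.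
Proof. by apply/tens_classP; rewrite tens_reprK. Qed.

Lemma tens_addE s t : tens_add (tens_class s) (tens_class t) = tens_class (s ++ t).
Proof. by apply/tens_classP; apply: TensCat; apply: tens_repr. Qed.

Lemma tens_rel_maplin (f : A -> A) (g : B -> B) :
  linear f -> linear g ->
  forall s t, tens_rel s t ->
  tens_rel [seq (f p.1, g p.2) | p <- s] [seq (f p.1, g p.2) | p <- t].
Proof.
move=> fl gl s t.
have f0 : f 0 = 0.
  by have := fl (-1) 0 0; rewrite scaler0 addr0 => ->; rewrite scaleN1r addNr.
have g0 : g 0 = 0.
  by have := gl (-1) 0 0; rewrite scaler0 addr0 => ->; rewrite scaleN1r addNr.
elim=> {s t} /=.
- by move=> s; apply: TensRefl.
- by move=> s t _; apply: TensSym.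
- by move=> s t u _ h _; apply: TensTrans.
- by move=> s s' t t' _ hs _ ht; rewrite !map_cat; apply: TensCat.
- by move=> s t; rewrite !map_cat; apply: TensCatC.
- by move=> b; rewrite f0; apply: Tens0l.
- move=> a a' b; have := fl 1 a a'; rewrite !scale1r => ->; exact: TensDl.
- move=> a b b'; have := gl 1 b b'; rewrite !scale1r => ->; exact: TensDr.
- move=> c a b; have := fl c a 0; have := gl c b 0.
  by rewrite !addr0 f0 g0 !addr0 => -> ->; apply: TensZ.
Qed.

Lemma linear_opp (V : lmodType k) : linear (fun v : V => - v).
Proof. by move=> c u v; rewrite opprD scalerN. Qed.

Lemma linear_scale (V : lmodType k) (d : k) : linear (fun v : V => d *: v).
Proof. by move=> c u v; rewrite scalerDr !scalerA mulrC. Qed.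

Lemma linear_mull (C : comAlgType k) (d : C) : linear (fun v : C => d * v).
Proof. by move=> c u v; rewrite mulrDr scalerAr. Qed.

Lemma linear_id (V : lmodType k) : linear (fun v : V => v).
Proof. by []. Qed.

Lemma tens_oppE s :
  tens_opp (tens_class s) = tens_class [seq (- p.1, p.2) | p <- s].
Proof.
apply/tens_classP.
exact: (tens_rel_maplin (@linear_opp A) (@linear_id B) (tens_repr s)).
Qed.

Lemma tens_scaleE c s :
  tens_scale c (tens_class s) = tens_class [seq (c *: p.1, p.2) | p <- s].
Proof.
apply/tens_classP.
exact: (tens_rel_maplin (@linear_scale A c) (@linear_id B) (tens_repr s)).
Qed.

Lemma tens_mulseq_catl s s' t :
  tens_mulseq (s ++ s') t = tens_mulseq s t ++ tens_mulseq s' t.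
Proof. exact: allpairs_cat. Qed.

Lemma tens_mulseq_cons p s t :
  tens_mulseq (p :: s) t = [seq (p.1 * q.1, p.2 * q.2) | q <- t] ++ tens_mulseq s t.
Proof. by []. Qed.

Lemma tens_mulseq0 s : tens_mulseq s [::] = [::].
Proof. by elim: s. Qed.

Lemma tens_rel_mulr s t t' :
  tens_rel t t' -> tens_rel (tens_mulseq s t) (tens_mulseq s t').
Proof.
move=> h; elim: s => [|[a b] s IHs]; first exact: TensRefl.
rewrite !tens_mulseq_cons; apply: TensCat IHs.
exact: (tens_rel_maplin (@linear_mull A a) (@linear_mull B b) h).
Qed.

Lemma tens_rel_mulC s t : tens_rel (tens_mulseq s t) (tens_mulseq t s).
Proof.
elim: s t => [|[a b] s IHs] t.
  by rewrite tens_mulseq0; apply: TensRefl.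
elim: t => [|[a' b'] t IHt].
  by rewrite tens_mulseq0; apply: TensRefl.
rewrite !tens_mulseq_cons /= (mulrC a') (mulrC b') -cat1s -[X in tens_rel _ X]cat1s.
apply: TensCat; first exact: TensRefl.
apply: TensTrans (TensCat (TensRefl _) (IHs _)) _.
apply: TensTrans (TensCat (TensRefl _) IHt).
rewrite !tens_mulseq_cons !catA.
apply: TensCat (TensCatC _ _) (TensSym (IHs _)).
Qed.

Lemma tens_mulE s t :
  tens_mul (tens_class s) (tens_class t) = tens_class (tens_mulseq s t).
Proof.
apply/tens_classP; apply: TensTrans (tens_rel_mulr _ (tens_repr t)) _.
apply: TensTrans (tens_rel_mulC _ _) _.
by apply: TensTrans (tens_rel_mulr _ (tens_repr s)) (tens_rel_mulC _ _).
Qed.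

Fact tens_addA : associative tens_add.
Proof.
elim/tens_ind=> s; elim/tens_ind=> t; elim/tens_ind=> u.
by rewrite !tens_addE catA.
Qed.

Fact tens_addC : commutative tens_add.
Proof.
elim/tens_ind=> s; elim/tens_ind=> t.
by rewrite !tens_addE; apply/tens_classP/TensCatC.
Qed.

Fact tens_add0 : left_id (tens_class [::]) tens_add.
Proof. by elim/tens_ind=> s; rewrite tens_addE. Qed.

Fact tens_addN : left_inverse (tens_class [::]) tens_opp tens_add.
Proof.
elim/tens_ind=> s; rewrite tens_oppE tens_addE; apply/tens_classP.
elim: s => [|[a b] s IHs] /=; first exact: TensRefl.
rewrite -cat1s -[(a, b) :: s]cat1s.
apply: TensTrans (TensCat (TensRefl _) (TensCatC _ _)) _.
rewrite !catA -catA -[[::]]cats0.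
apply: TensCat; last exact: TensTrans (TensCatC _ _) IHs.
apply: TensTrans (TensSym (TensDl _ _ _)) _.
by rewrite addNr; apply: Tens0l.
Qed.

HB.instance Definition _ :=
  GRing.isZmodule.Build tensor tens_addA tens_addC tens_add0 tens_addN.

Fact tens_mulA : associative tens_mul.
Proof.
elim/tens_ind=> s; elim/tens_ind=> t; elim/tens_ind=> u.
rewrite !tens_mulE; congr tens_class.
elim: s => [|[a b] s IHs] //.
rewrite !tens_mulseq_cons tens_mulseq_catl IHs; congr (_ ++ _).
elim: t {IHs} => [|[a' b'] t IHt] //.
rewrite map_cons !tens_mulseq_cons map_cat IHt; congr (_ ++ _).
by rewrite -map_comp; apply: eq_map => -[a'' b''] /=; rewrite !mulrA.
Qed.

Fact tens_mulC : commutative tens_mul.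
Proof.
elim/tens_ind=> s; elim/tens_ind=> t; rewrite !tens_mulE.
exact/tens_classP/tens_rel_mulC.
Qed.

Fact tens_mul1 : left_id (tens_class [:: (1, 1)]) tens_mul.
Proof.
elim/tens_ind=> s; rewrite tens_mulE tens_mulseq_cons cats0; congr tens_class.
by rewrite -[RHS]map_id; apply: eq_map => -[a b] /=; rewrite !mul1r.
Qed.

Fact tens_mulD : left_distributive tens_mul tens_add.
Proof.
elim/tens_ind=> s; elim/tens_ind=> t; elim/tens_ind=> u.
by rewrite !(tens_mulE, tens_addE) tens_mulseq_catl.
Qed.

End TensorRelation.

(* Needed to see that the tensor product of two nonzero algebras over a field
   is nonzero. *)
Section UnitalFunctional.
Variables (k : fieldType) (A : comAlgType k).
Local Open Scope classical_set_scope.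

Lemma unital_functional : exists2 f : A -> k^o, linear f & f 1 = 1.
Proof.
pose sub (W : set A) := (forall c u v, W u -> W v -> W (c *: u + v)) /\ ~ W 1.
have [F subF totF|W [[WL W1] Wmax]] := @Zorn_bigcup A sub.
  split=> [c u v [X FX Xu] [Y FY Yv]|[X FX X1]]; last by have [] := subF _ FX.
  have [XY|YX] := totF _ _ FX FY.
    by exists Y => //; apply: (subF _ FY).1 => //; apply: XY.
  by exists X => //; apply: (subF _ FX).1 => //; apply: YX.
have W0 : W 0.
  apply: contrapT => W0; apply: (Wmax [set 0]).
    split=> [e We|/(_ 0 erefl)//].
    by case: W0; have := WL (-1) e e We We; rewrite scaleN1r addNr.
  split=> [c u v -> ->|/eqP]; first by rewrite /set1/= scaler0 addr0.
  by rewrite oner_eq0.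
have WZ c u : W u -> W (c *: u).
  by move=> Wu; have := WL c u 0 Wu W0; rewrite addr0.
have WD u v : W u -> W v -> W (u + v).
  by move=> Wu Wv; have := WL 1 u v Wu Wv; rewrite scale1r.
have Wdec a : exists c, W (a - c *: 1).
  apply: contrapT => noc.
  pose W' := [set x | exists c w, W w /\ x = c *: a + w].
  apply: (Wmax W').
    split=> [w Ww|W'W]; first by exists 0, w; rewrite scale0r add0r.
    have Wa : W a by apply: W'W; exists 1, 0; rewrite scale1r addr0.
    by apply: noc; exists 0; rewrite scale0r subr0.
  split=> [c _ _ [d [u [Wu ->]]] [e [v [Wv ->]]]|[c [w [Ww e1]]]].
    exists (c * d + e), (c *: u + v); split; first exact: WL.
    by rewrite scalerDr scalerDl scalerA addrACA.
  have [c0|c0] := eqVneq c 0.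
    by apply: W1; rewrite e1 c0 scale0r add0r.
  apply: noc; exists c^-1; rewrite e1 scalerDr scalerA mulVf// scale1r.
  rewrite opprD addrA subrr add0r -scaleN1r.
  by apply/WZ/WZ.
pose f a : k^o := projT1 (cid (Wdec a)).
have fW a : W (a - f a *: 1) by rewrite /f; case: cid.
have funi a c : W (a - c *: 1) -> f a = c.
  move=> Wc; apply/eqP; rewrite -subr_eq0; apply/eqP.
  apply: contrapT => /eqP d0; apply: W1.
  have := WD _ _ Wc (WZ (-1) _ (fW a)).
  rewrite scaleN1r opprB addrC addrA subrK -scalerBl => /(WZ (f a - c)^-1).
  by rewrite scalerA mulVf// scale1r.
exists f => [c u v|]; last by apply: funi; rewrite scale1r subrr.
apply: funi; have := WL c _ _ (fW u) (fW v).
by rewrite scalerBr scalerDl opprD addrACA scalerA.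
Qed.

End UnitalFunctional.

Section TensorAlgebra.
Variables (k : fieldType) (A B : comAlgType k).
Local Notation T := (tensor A B).

Fact tens_one_neq0 : tens_class [:: (1, 1)] != 0 :> T.
Proof.
apply/eqP => /tens_classP.
have [f fl f1] := unital_functional A; have [g gl g1] := unital_functional B.
move/(@tens_rel_sum _ _ _ k^o (fun a b => f a * g b)) => /=.
rewrite /tens_sum big_seq1 big_nil /= f1 g1 mulr1 => h.
suff: (1 : k^o) = 0 by move/eqP; rewrite oner_eq0.
apply: h => [b c u v|a c u v].
  by rewrite fl mulrDl scalerAl.
by rewrite gl mulrDr scalerAr.
Qed.

HB.instance Definition _ :=
  GRing.Zmodule_isComNzRing.Build T (@tens_mulA k A B) (@tens_mulC k A B)
    (@tens_mul1 k A B) (@tens_mulD k A B) tens_one_neq0.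

Fact tens_scaleA a b (v : T) :
  tens_scale a (tens_scale b v) = tens_scale (a * b) v.
Proof.
elim/tens_ind: v => s; rewrite !tens_scaleE -map_comp; congr tens_class.
by apply: eq_map => p /=; rewrite scalerA.
Qed.

Fact tens_scale1 : left_id 1 (@tens_scale k A B).
Proof.
elim/tens_ind=> s; rewrite tens_scaleE; congr tens_class.
by rewrite -[RHS]map_id; apply: eq_map => -[a b] /=; rewrite scale1r.
Qed.

Fact tens_scaleDr : right_distributive (@tens_scale k A B) +%R.
Proof.
move=> c; elim/tens_ind=> s; elim/tens_ind=> t.
rewrite [X in tens_scale c X]tens_addE !tens_scaleE.
by rewrite map_cat -tens_addE.
Qed.

Fact tens_scaleDl (v : T) :
  {morph (@tens_scale k A B)^~ v : a b / a + b >-> a + b}.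
Proof.
elim/tens_ind: v => s c d /=; rewrite !tens_scaleE.
rewrite [RHS]tens_addE; apply/tens_classP.
elim: s => [|[a b] s IHs] /=; first exact: TensRefl.
rewrite -cat1s.
apply: TensTrans (TensCat _ IHs) _.
  by rewrite scalerDl; apply: TensDl.
rewrite -cat1s -[X in tens_rel _ X]cat1s -catA.
apply: TensCat; first exact: TensRefl.
rewrite -[X in tens_rel _ (_ ++ X)]cat1s !catA.
apply: TensCat; last exact: TensRefl.
exact: TensCatC.
Qed.

HB.instance Definition _ :=
  GRing.Zmodule_isLmodule.Build k T tens_scaleA tens_scale1
    tens_scaleDr tens_scaleDl.

Fact tens_scaleAl (c : k) (x y : T) : c *: (x * y) = (c *: x) * y.
Proof.
elim/tens_ind: x => s; elim/tens_ind: y => t.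
have mE u v : tens_class u * tens_class v = tens_class (tens_mulseq u v) :> T.
  exact: tens_mulE.
have zE d u : d *: (tens_class u : T) =
  tens_class [seq (d *: p.1, p.2) | p <- u] by exact: tens_scaleE.
rewrite [c *: tens_class s]zE !mE zE; congr tens_class.
elim: s => [|[a b] s IHs] //.
rewrite map_cons !tens_mulseq_cons map_cat IHs; congr (_ ++ _).
rewrite -map_comp; apply: eq_map => p /=.
by rewrite scalerAl.
Qed.

HB.instance Definition _ := GRing.Lmodule_isLalgebra.Build k T tens_scaleAl.
HB.instance Definition _ := GRing.Lalgebra_isComAlgebra.Build k T.

Definition tmul (a : A) (b : B) : T := tens_class [:: (a, b)].

Lemma tmulDl a a' b : tmul (a + a') b = tmul a b + tmul a' b.
Proof. by rewrite [RHS]tens_addE; apply/tens_classP/TensDl. Qed.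

Lemma tmulDr a b b' : tmul a (b + b') = tmul a b + tmul a b'.
Proof. by rewrite [RHS]tens_addE; apply/tens_classP/TensDr. Qed.

Lemma tmulZl c a b : tmul (c *: a) b = c *: tmul a b.
Proof. by rewrite [RHS]tens_scaleE. Qed.

Lemma tmulZr c a b : tmul a (c *: b) = c *: tmul a b.
Proof. by rewrite -tmulZl; apply/esym/tens_classP/TensZ. Qed.

Lemma tmulM a a' b b' : tmul a b * tmul a' b' = tmul (a * a') (b * b').
Proof. by rewrite [LHS]tens_mulE. Qed.

Lemma tmul1 : tmul 1 1 = 1.
Proof. by []. Qed.

Lemma tensorE (x : T) :
  x = \sum_(p <- repr (x : {eq_quot tens_equiv A B})) tmul p.1 p.2.
Proof.
rewrite -[LHS]tens_reprK; elim: (repr _) => [|[a b] s IHs].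
  by rewrite big_nil.
by rewrite big_cons -IHs /= [RHS]tens_addE.
Qed.

Definition tens_inl (a : A) : T := tmul a 1.
Definition tens_inr (b : B) : T := tmul 1 b.

Fact tens_inl_linear : linear tens_inl.
Proof. by move=> c a a'; rewrite /tens_inl tmulDl tmulZl. Qed.
Fact tens_inl_monoid : monoid_morphism tens_inl.
Proof. by split=> // a a'; rewrite /tens_inl tmulM mulr1. Qed.
HB.instance Definition _ :=
  GRing.isLinear.Build k A T *:%R tens_inl tens_inl_linear.
HB.instance Definition _ :=
  GRing.isMonoidMorphism.Build A T tens_inl tens_inl_monoid.

Fact tens_inr_linear : linear tens_inr.
Proof. by move=> c b b'; rewrite /tens_inr tmulDr tmulZr. Qed.
Fact tens_inr_monoid : monoid_morphism tens_inr.
Proof. by split=> // b b'; rewrite /tens_inr tmulM mulr1. Qed.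
HB.instance Definition _ :=
  GRing.isLinear.Build k B T *:%R tens_inr tens_inr_linear.
HB.instance Definition _ :=
  GRing.isMonoidMorphism.Build B T tens_inr tens_inr_monoid.

End TensorAlgebra.

Section TensorLift.
Variables (k : fieldType) (A B C : comAlgType k).
Variables (f : {lrmorphism A -> C}) (g : {lrmorphism B -> C}).
Local Notation T := (tensor A B).

Definition tens_lift (x : T) : C :=
  tens_sum (fun a b => f a * g b) (repr (x : {eq_quot tens_equiv A B})).

Lemma tens_lift_class s :
  tens_lift (tens_class s) = tens_sum (fun a b => f a * g b) s.
Proof.
apply: (@tens_rel_sum _ _ _ C) (tens_repr s) => [b|a] c u v /=.
  by rewrite linearP mulrDl scalerAl.
by rewrite linearP mulrDr scalerAr.
Qed.

Lemma tens_lift_tmul a b : tens_lift (tmul a b) = f a * g b.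
Proof. by rewrite tens_lift_class /tens_sum big_seq1. Qed.

Fact tens_lift_linear : linear tens_lift.
Proof.
move=> c; elim/tens_ind=> s; elim/tens_ind=> t.
have -> : c *: tens_class s + tens_class t
  = tens_class ([seq (c *: p.1, p.2) | p <- s] ++ t) :> T.
  by rewrite -tens_addE -tens_scaleE.
rewrite !tens_lift_class /tens_sum big_cat big_map /=; congr (_ + _).
by rewrite scaler_sumr; apply: eq_bigr => p _; rewrite linearZ scalerAl.
Qed.

HB.instance Definition _ :=
  GRing.isLinear.Build k T C *:%R tens_lift tens_lift_linear.

Fact tens_lift_monoid : monoid_morphism tens_lift.
Proof.
split=> [|x y]; first by rewrite -tmul1 tens_lift_tmul !rmorph1 mulr1.
rewrite [x]tensorE [y]tensorE mulr_suml !linear_sum mulr_suml.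
apply: eq_bigr => p _; rewrite mulr_sumr !linear_sum mulr_sumr.
apply: eq_bigr => q _; rewrite tmulM /= !tens_lift_tmul !rmorphM.
by rewrite mulrACA.
Qed.

HB.instance Definition _ :=
  GRing.isMonoidMorphism.Build T C tens_lift tens_lift_monoid.

End TensorLift.

Definition tens_map (k : fieldType) (A B C D : comAlgType k)
    (f : {lrmorphism A -> C}) (g : {lrmorphism B -> D}) :
    {lrmorphism tensor A B -> tensor C D} :=
  tens_lift (@tens_inl k C D \o f) (@tens_inr k C D \o g).

Definition tens_assoc (k : fieldType) (A B C : comAlgType k) :
    {lrmorphism tensor (tensor A B) C -> tensor A (tensor B C)} :=
  tens_lift
    (tens_lift (@tens_inl k A (tensor B C))
               (@tens_inr k A (tensor B C) \o @tens_inl k B C))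
    (@tens_inr k A (tensor B C) \o @tens_inr k B C).

(* An affine group scheme over k, presented by its coordinate Hopf algebra
   k[G]. *)
Record affine_group (k : fieldType) := AffineGroup {
  coord_ring :> comAlgType k;
  comul : {lrmorphism coord_ring -> tensor coord_ring coord_ring};
  counit : {lrmorphism coord_ring -> k^o};
  antipode : {lrmorphism coord_ring -> coord_ring};
  comulA : forall h,
    tens_assoc _ _ _ (tens_map comul idfun (comul h))
    = tens_map idfun comul (comul h);
  comul1l : forall h, tens_map counit idfun (comul h) = tmul 1 h;
  comul1r : forall h, tens_map idfun counit (comul h) = tmul h 1;
  comulVl : forall h, tens_lift antipode idfun (comul h) = (counit h)%:A;
  comulVr : forall h, tens_lift idfun antipode (comul h) = (counit h)%:A
}.

Definition algebra_fin_gen (k : fieldType) (A : comAlgType k) : Prop :=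
  exists s : seq A, forall U : {pred A},
    GRing.subalg_closed U -> {subset s <= U} -> forall a, a \in U.

(* Infinitesimal lifting: C = B / I with I = ker p of square zero. *)
Definition formally_smooth (k : fieldType) (A : comAlgType k) : Prop :=
  forall (B C : comAlgType k) (p : {lrmorphism B -> C}),
    (forall c, exists b, p b = c) ->
    (forall x y, p x = 0 -> p y = 0 -> x * y = 0) ->
    forall f : {lrmorphism A -> C},
      exists g : {lrmorphism A -> B}, forall a, p (g a) = f a.

(* Smooth means formally smooth and locally of finite presentation; over a
   field the latter is finite generation of k[G], i.e. G is algebraic. *)
Definition smooth_algebraic_group (k : fieldType) (G : affine_group k) : Prop :=
  algebra_fin_gen G /\ formally_smooth G.

Section Points.
Variables (k : fieldType) (G : affine_group k) (R : comAlgType k).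

Definition points : Type := {lrmorphism G -> R}.

Definition point_mul (g h : points) : points := tens_lift g h \o comul G.

End Points.

Record coaction (k : fieldType) (G : affine_group k) (S : comAlgType k) :=
  Coaction {
  coact :> {lrmorphism S -> tensor S G};
  coactA : forall s,
    tens_assoc _ _ _ (tens_map coact idfun (coact s))
    = tens_map idfun (comul G) (coact s);
  coact1 : forall s, tens_map idfun (counit G) (coact s) = tmul s 1
}.

Section Invariants.
Variables (k : fieldType) (G : affine_group k) (S : comAlgType k).
Variable w : coaction G S.

Definition is_invariant : {pred S} := fun s => w s == tmul s 1.

Fact invariant_subalg : GRing.subalg_closed is_invariant.
Proof.
split=> [|c u v /eqP hu /eqP hv|u v /eqP hu /eqP hv]; apply/eqP.
- by rewrite rmorph1.
- by rewrite linearP /= tmulDl tmulZl hu hv.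
- by rewrite rmorphM /= hu hv tmulM mulr1.
Qed.

HB.instance Definition _ :=
  GRing.isSubalgClosed.Build k S is_invariant invariant_subalg.

Record invariant_ring := InvariantRing {
  invariant_val :> S;
  _ : invariant_val \in is_invariant
}.

HB.instance Definition _ := [isSub for invariant_val].
HB.instance Definition _ := [Choice of invariant_ring by <:].
HB.instance Definition _ :=
  [SubChoice_isSubComNzRing of invariant_ring by <:].
HB.instance Definition _ := [SubZmodule_isSubLmodule of invariant_ring by <:].
HB.instance Definition _ :=
  [SubNzRing_SubLmodule_isSubLalgebra of invariant_ring by <:].
HB.instance Definition _ := [SubLalgebra_isSubAlgebra of invariant_ring by <:].

End Invariants.

Section IntegralClosure.
Variables (k : fieldType) (S : comAlgType k).

Definition is_integral : {pred S} := fun s => `[< integralOver (in_alg S) s >].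

Fact integral_subalg : GRing.subalg_closed is_integral.
Proof.
split=> [|c u v /asboolP hu /asboolP hv|u v /asboolP hu /asboolP hv];
  apply/asboolP.
- exact: integral1.
- rewrite -mulr_algl; apply: integral_add => //; apply: integral_mul => //.
  exact: integral_id.
- exact: integral_mul.
Qed.

HB.instance Definition _ :=
  GRing.isSubalgClosed.Build k S is_integral integral_subalg.

Record integral_closure := IntegralClosure {
  integral_closure_val :> S;
  _ : integral_closure_val \in is_integral
}.

HB.instance Definition _ := [isSub for integral_closure_val].
HB.instance Definition _ := [Choice of integral_closure by <:].
HB.instance Definition _ :=
  [SubChoice_isSubComNzRing of integral_closure by <:].
HB.instance Definition _ := [SubZmodule_isSubLmodule of integral_closure by <:].
HB.instance Definition _ :=
  [SubNzRing_SubLmodule_isSubLalgebra of integral_closure by <:].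
HB.instance Definition _ := [SubLalgebra_isSubAlgebra of integral_closure by <:].

End IntegralClosure.

Section Factoriality.
Variable R : comNzRingType.
Implicit Types (x y p : R) (s t : seq R).

Definition is_unit x : Prop := exists y, y * x = 1.

Definition associated x y : Prop := exists2 u, is_unit u & y = u * x.

Definition irreducible p : Prop :=
  [/\ p <> 0, ~ is_unit p
    & forall x y, p = x * y -> is_unit x \/ is_unit y].

Definition is_domain : Prop := forall x y, x * y = 0 -> x = 0 \/ y = 0.

Definition is_ufd : Prop :=
  [/\ is_domain,
      forall x, x <> 0 -> ~ is_unit x ->
        exists2 s, (forall p, p \in s -> irreducible p) & x = \prod_(p <- s) p
    & forall s t,
        (forall p, p \in s -> irreducible p) ->
        (forall p, p \in t -> irreducible p) ->
        \prod_(p <- s) p = \prod_(p <- t) p ->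
        exists t', [/\ perm_eq t t', size s = size t'
          & forall i, (i < size s)%N -> associated s`_i t'`_i]].

End Factoriality.

Definition prime_ideal (R : comNzRingType) (P : {pred R}) : Prop :=
  idealr_closed P /\ prime_idealr_closed P.

(* G(K) is dense in Spec (K (x) k[G]): a g in G(K) is the point given by the
   kernel of the induced K-algebra map K (x) k[G] -> K, and a closed set V(E)
   containing all those points is the whole spectrum. *)
Definition points_dense (k : fieldType) (G : affine_group k)
    (K : comAlgType k) : Prop :=
  forall E : {pred tensor K G},
    (forall (g : points G K) x, x \in E -> tens_lift idfun g x = 0) ->
    forall P : {pred tensor K G}, prime_ideal P -> {subset E <= P}.

(* A homomorphism K (x) G -> G_m of K-groups, as a natural family of group
   homomorphisms (K (x) G)(R) = G(R) -> R^* , where R runs over the K-algebras,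
   i.e. the k-algebras R with a k-algebra map j : K -> R. *)
Record character (k : fieldType) (G : affine_group k) (K : comAlgType k) :=
  Character {
  char_val : forall R : comAlgType k, {lrmorphism K -> R} -> points G R -> R;
  char_unit : forall R j g, is_unit (@char_val R j g);
  charM : forall R j g h,
    @char_val R j (point_mul g h) = char_val j g * char_val j h;
  char_nat : forall (R R' : comAlgType k) (f : {lrmorphism R -> R'})
      (j : {lrmorphism K -> R}) (g : points G R),
    char_val (f \o j) (f \o g) = f (char_val j g)
}.

Definition trivial_characters (k : fieldType) (G : affine_group k)
    (K : comAlgType k) : Prop :=
  forall (chi : character G K) (R : comAlgType k) (j : {lrmorphism K -> R})
    (g : points G R), char_val chi j g = 1.

(* Main.v *)
Require Import Defs.
From HB Require Import structures.
From mathcomp Require Import all_boot all_order all_algebra.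
From mathcomp Require Import zify ring.
From mathcomp Require Import boolp classical_sets.
From mathcomp.multinomials Require Import mpoly.
Set Implicit Arguments.
Unset Strict Implicit.
Unset Printing Implicit Defensive.
Import GRing.Theory.
Local Open Scope ring_scope.
Local Open Scope quotient_scope.

(** The field [K] consists of invariants, so the group [G(K)] acts on [S] by
    automorphisms fixing [K]. Let [p] be an irreducible factor in [S] of an
    invariant [a], and let [f] be the product of the finitely many classes up to
    units in the [G(K)]-orbit of [p]. Then [f] divides every invariant divisible
    by [p], and [g f] is associated to [f] for all [g] in [G(K)]. Since
    [K (x) k[G]] is reduced and [G(K)] is dense, an element of [S (x) k[G]] lies
    in [V (x) k[G]], for a [K]-subspace [V] of [S], as soon as its values at the
    points of [G(K)] lie in [V]. With [V = f S] this gives [w f = f chi]. The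
    values of [chi] are units forming a group inside a finite-dimensional
    [K]-subspace of [S], hence they are algebraic over [K] and lie in [K]; with
    [V = K] this gives [chi] in [K (x) k[G]], a group-like element, that is a
    character. So [chi = 1], [f] is invariant, and [f] is prime in [S^G].

    Reducedness of [R = F (x) k[G]] for a field [F]: let [x] be nilpotent and
    nonzero, [m] a maximal ideal containing its annihilator and [L = R / m].
    Over [L] there is a rational point [e] above [m]. Formal smoothness lifts
    [x] to a polynomial over [L] whose powers vanish to high order at that
    point, so [x] lies in all powers of [ker e], and Krull's intersection
    theorem yields [(1 - a) x = 0] with [e a = 0]. By flatness [1 - a] comes
    from the annihilator of [x], which [e] kills: contradiction. *)

(** * Restricted scalars, fields among algebras, quotient algebras *)

Section ScalarRestriction.
Variables (k : fieldType) (R : comNzRingType).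

(* The unused argument [i] selects the scalar action. *)
Definition restr_alg (i : {rmorphism k -> R}) : Type := R.
HB.instance Definition _ i := GRing.ComNzRing.on (restr_alg i).

Variable i : {rmorphism k -> R}.
Local Notation restricted := (restr_alg i).

Let scale (c : k) (x : restricted) : restricted := i c * x.
Fact restr_scaleA a b x : scale a (scale b x) = scale (a * b) x.
Proof. by rewrite /scale rmorphM mulrA. Qed.
Fact restr_scale1 : left_id 1 scale.
Proof. by move=> x; rewrite /scale rmorph1 mul1r. Qed.
Fact restr_scaleDr : right_distributive scale +%R.
Proof. by move=> c x y; rewrite /scale mulrDr. Qed.
Fact restr_scaleDl x : {morph scale^~ x : a b / a + b >-> a + b}.
Proof. by move=> a b; rewrite /scale rmorphD mulrDl. Qed.
HB.instance Definition _ := GRing.Zmodule_isLmodule.Build k restricted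
  restr_scaleA restr_scale1 restr_scaleDr restr_scaleDl.
Fact restr_scaleAl (c : k) (x y : restricted) : c *: (x * y) = (c *: x) * y.
Proof. exact: mulrA. Qed.
HB.instance Definition _ := GRing.Lmodule_isLalgebra.Build k restricted restr_scaleAl.
HB.instance Definition _ := GRing.Lalgebra_isComAlgebra.Build k restricted.

End ScalarRestriction.

Definition field_prop (R : comNzRingType) : Prop :=
  forall x : R, x <> 0 -> is_unit x.

Section FieldOf.
Variables (k : fieldType) (K : comAlgType k).

(** The proof [hK] is a phantom argument that carries the field structure; the [k]-algebra structure
    of [K] is kept beside it. *)
Definition field_alg (hK : field_prop K) : Type := K.
HB.instance Definition _ hK := GRing.ComAlgebra.on (field_alg hK).

Variable hK : field_prop K.
Local Notation field_of := (field_alg hK).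

Let inv (x : field_of) : field_of :=
  if pselect (x <> 0) is left nz then sval (cid (hK nz)) else 0.
Fact field_of_mulVx (x : field_of) : x != 0 -> inv x * x = 1.
Proof.
by move=> /eqP nz; rewrite /inv; case: pselect => // nz'; case: cid.
Qed.
Fact field_of_inv0 : inv 0 = 0.
Proof. by rewrite /inv; case: pselect. Qed.
HB.instance Definition _ :=
  GRing.ComNzRing_isField.Build field_of field_of_mulVx field_of_inv0.

Definition to_field_alg (x : K) : field_of := x.
Fact to_field_alg_linear : linear to_field_alg. Proof. by []. Qed.
Fact to_field_alg_monoid : monoid_morphism to_field_alg. Proof. by []. Qed.
HB.instance Definition _ :=
  GRing.isLinear.Build k K field_of *:%R to_field_alg to_field_alg_linear.
HB.instance Definition _ :=
  GRing.isMonoidMorphism.Build K field_of to_field_alg to_field_alg_monoid.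
End FieldOf.


Section Quotient.
Variables (k : fieldType) (B : comAlgType k) (I : {pred B}).

Definition ideal_pred of idealr_closed I : {pred B} := I.

Variable hI : idealr_closed I.
HB.instance Definition _ := isIdealr.Build B (ideal_pred hI) hI.

Definition quo : Type := {ideal_quot (ideal_pred hI)}.
HB.instance Definition _ := GRing.ComNzRing.on quo.

Definition quo_pi (x : B) : quo := \pi_({ideal_quot (ideal_pred hI)}) x.
Fact quo_pi_zmod : zmod_morphism quo_pi.
Proof. exact: (rmorphB (\pi_({ideal_quot (ideal_pred hI)}))). Qed.
Fact quo_pi_monoid : monoid_morphism quo_pi.
Proof.
by split=> [|x y]; [exact: (rmorph1 (\pi_({ideal_quot (ideal_pred hI)})))
  | exact: (rmorphM (\pi_({ideal_quot (ideal_pred hI)})))].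
Qed.
HB.instance Definition _ := GRing.isZmodMorphism.Build B quo quo_pi quo_pi_zmod.
HB.instance Definition _ := GRing.isMonoidMorphism.Build B quo quo_pi quo_pi_monoid.

Lemma quo_pi_surj (y : quo) : exists x, quo_pi x = y.
Proof. by exists (repr y); rewrite /quo_pi reprK. Qed.

Lemma quo_piP x y : quo_pi x = quo_pi y <-> x - y \in I.
Proof.
rewrite -[_ \in I]/(x - y \in ideal_pred hI) Quotient.idealrBE.
by split=> /eqP.
Qed.

Let scale (c : k) (y : quo) : quo := quo_pi c%:A * y.
Fact quo_scaleA a b x : scale a (scale b x) = scale (a * b) x.
Proof. by rewrite /scale mulrA -rmorphM /= -scalerAl mul1r scalerA. Qed.
Fact quo_scale1 : left_id 1 scale.
Proof. by move=> x; rewrite /scale scale1r rmorph1 mul1r. Qed.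
Fact quo_scaleDr : right_distributive scale +%R.
Proof. by move=> c x y; rewrite /scale mulrDr. Qed.
Fact quo_scaleDl x : {morph scale^~ x : a b / a + b >-> a + b}.
Proof. by move=> a b; rewrite /scale scalerDl rmorphD mulrDl. Qed.
HB.instance Definition _ := GRing.Zmodule_isLmodule.Build k quo
  quo_scaleA quo_scale1 quo_scaleDr quo_scaleDl.
Fact quo_scaleAl (c : k) (x y : quo) : c *: (x * y) = (c *: x) * y.
Proof. exact: mulrA. Qed.
HB.instance Definition _ := GRing.Lmodule_isLalgebra.Build k quo quo_scaleAl.
HB.instance Definition _ := GRing.Lalgebra_isComAlgebra.Build k quo.

Fact quo_pi_scalable : scalable quo_pi.
Proof. by move=> c x; rewrite -[RHS]rmorphM /= -scalerAl mul1r. Qed.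
HB.instance Definition _ :=
  GRing.isScalable.Build k B quo *:%R quo_pi quo_pi_scalable.


Lemma quo_factor (C : comAlgType k) (f : {lrmorphism B -> C}) :
  (forall x, x \in I -> f x = 0) ->
  exists g : {lrmorphism quo -> C}, forall x, g (quo_pi x) = f x.
Proof.
move=> fI; pose g (y : quo) : C := f (sval (cid (quo_pi_surj y))).
have gpi x : g (quo_pi x) = f x.
  rewrite /g; case: cid => z /= /quo_piP/fI; rewrite rmorphB => /eqP.
  by rewrite subr_eq0 => /eqP.
have glin : linear g.
  move=> c y z; have [a <-] := quo_pi_surj y; have [b <-] := quo_pi_surj z.
  by rewrite -linearP /= !gpi linearP.
have gmon : monoid_morphism g.
  split=> [|y z]; first by rewrite -[1](rmorph1 quo_pi) gpi rmorph1.
  have [a <-] := quo_pi_surj y; have [b <-] := quo_pi_surj z.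
  by rewrite -rmorphM /= !gpi rmorphM.
pose G1 := GRing.isLinear.Build _ _ _ _ g glin.
pose G2 := GRing.isMonoidMorphism.Build _ _ g gmon.
pose gl : {lrmorphism quo -> C} := HB.pack g G1 G2.
by exists gl.
Qed.

End Quotient.

(** * Contraction of tensors by linear functionals *)

Definition submodule (R : comNzRingType) (V : lmodType R) (W : set V) : Prop :=
  W 0 /\ forall c u v, W u -> W v -> W (c *: u + v).

Section MaximalSubmodule.
Variables (R : comNzRingType) (V : lmodType R).
Local Open Scope classical_set_scope.

(** Zorn's lemma in a form that serves three times: with [T] a single vector over a field it yields
    a hyperplane, with [T] reduced to 1 a maximal ideal, with [T] the powers of an element a prime
    ideal. *)
Lemma maximal_submodule_avoiding (I T : set V) :
  submodule I -> (forall v, I v -> ~ T v) ->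
  exists W : set V, [/\ submodule W, I `<=` W, forall v, W v -> ~ T v
    & forall v, ~ W v -> exists c w, W w /\ T (c *: v + w)].
Proof.
move=> subI IT.
(* [I] is joined to [X] so that the empty union, coming from the empty chain, still satisfies
   [P]. *)
pose P (X : set V) := submodule (I `|` X) /\ forall v, (I `|` X) v -> ~ T v.
have [F PF totF|W [[subW WT] maxW]] := @Zorn_bigcup V P.
  have lift X : F X -> I `|` X `<=` I `|` \bigcup_(X in F) X.
    by move=> FX v [Iv|Xv]; [left|right; exists X].
  split; last first.
    by move=> v [/IT//|[X FX Xv]]; apply: (PF _ FX).2; right.
  split=> [|c u v]; first by left; case: subI.
  move=> [Iu|[X FX Xu]] [Iv|[Y FY Yv]].
  - by left; apply: subI.2.
  - by apply: (lift _ FY); refine ((PF _ FY).1.2 c u v _ _); [left|right].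
  - by apply: (lift _ FX); refine ((PF _ FX).1.2 c u v _ _); [right|left].
  have [XY|YX] := totF _ _ FX FY.
    by apply: (lift _ FY); refine ((PF _ FY).1.2 c u v _ _); right=> //; apply: XY.
  by apply: (lift _ FX); refine ((PF _ FX).1.2 c u v _ _); right=> //; apply: YX.
exists (I `|` W); split=> // v nWv.
apply: contrapT => noc.
pose W' := [set x | exists c w, (I `|` W) w /\ x = c *: v + w].
have W'W : I `|` W `<=` W' by move=> w Ww; exists 0, w; rewrite scale0r add0r.
apply: (maxW W').
  split=> [w Ww|W'sW]; first by apply: W'W; right.
  apply: nWv; right; apply: W'sW; exists 1, 0; rewrite scale1r addr0.
  by split=> //; case: subW.
have -> : P W' = (submodule W' /\ forall v, W' v -> ~ T v).
  rewrite /P; suff -> : I `|` W' = W' by [].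
  by apply/seteqP; split=> [x [Ix|//]|x]; [apply: W'W; left|right].
split; last by move=> _ [c [w [Ww ->]]] Tx; apply: noc; exists c, w.
split=> [|c _ _ [d [u [Wu ->]]] [e [x [Wx ->]]]]; first by apply: W'W; case: subW.
exists (c * d + e), (c *: u + x); split; first exact: subW.2.
by rewrite scalerDr scalerDl scalerA addrACA.
Qed.

End MaximalSubmodule.

(** A submodule [M] maximal among those containing [W] and avoiding [h] is a complement of the line
    of [h]; [f v] is the unique [c] with [v - c *: h] in [M]. *)
Lemma separating_functional (k : fieldType) (V : lmodType k) (W : set V) h :
  submodule W -> ~ W h ->
  exists f : {linear V -> k^o}, (forall v, W v -> f v = 0) /\ f h = 1.
Proof.
move=> subW nWh.
have [v Wv vh|M [subM WM nMh maxM]] :=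
  @maximal_submodule_avoiding k V W [set h] subW; first by apply: nWh; rewrite -vh.
have MZ c u : M u -> M (c *: u).
  by move=> Mu; rewrite -[_ *: _]addr0; apply: subM.2 => //; case: subM.
have dec v : exists c, M (v - c *: h).
  case: (pselect (M v)) => [Mv|nMv]; first by exists 0; rewrite scale0r subr0.
  have [c [w [Mw e]]] := maxM v nMv.
  have c0 : c != 0.
    by apply/eqP => c0; apply: (nMh w) => //; rewrite /= -e c0 scale0r add0r.
  exists c^-1; rewrite -e scalerDr scalerA mulVf// scale1r opprD addrA subrr add0r.
  by rewrite -scalerN -scaleN1r; apply/MZ/MZ.
pose f v : k^o := projT1 (cid (dec v)).
have fP v : M (v - f v *: h) by rewrite /f; case: cid.
have funi v c : M (v - c *: h) -> f v = c.
  move=> Mc; apply/eqP; rewrite -subr_eq0; apply/eqP.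
  apply: contrapT => /eqP d0; apply: (nMh h) => //.
  have := subM.2 (-1) _ _ (fP v) Mc.
  rewrite scaleN1r opprB addrA subrK -scalerBl => /(MZ (f v - c)^-1).
  by rewrite scalerA mulVf// scale1r.
have flin : linear f.
  move=> c u v; apply: funi; have := subM.2 c _ _ (fP u) (fP v).
  by rewrite scalerBr scalerDl opprD addrACA scalerA.
pose F := GRing.isLinear.Build _ _ _ _ f flin.
pose fl : {linear V -> k^o} := HB.pack f F.
exists fl; split=> [v Wv|]; apply: funi; last first.
  by rewrite scale1r subrr; case: subM.
by rewrite scale0r subr0; apply: WM.
Qed.

Section Contraction.
Variables (k : fieldType) (A H : comAlgType k).

Lemma tmul0r (a : A) : tmul a (0 : H) = 0.
Proof. by rewrite -(scale0r (0 : H)) tmulZr scale0r. Qed.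

Lemma tmul0l (h : H) : tmul (0 : A) h = 0.
Proof. by rewrite -(scale0r (0 : A)) tmulZl scale0r. Qed.

Lemma tensor_sum (x : tensor A H) :
  exists (n : nat) (a : 'I_n -> A) (h : 'I_n -> H), x = \sum_(i < n) tmul (a i) (h i).
Proof.
rewrite [x]tensorE; set s := repr _.
exists (size s), (fun i => (nth (0, 0) s i).1), (fun i => (nth (0, 0) s i).2).
by rewrite (big_nth (0, 0)) big_mkord.
Qed.

Lemma tensor_indP (P : tensor A H -> Prop) :
  (forall a h, P (tmul a h)) -> (forall x y, P x -> P y -> P (x + y)) ->
  forall x, P x.
Proof.
move=> Pt PD x; have [n [a [h ->]]] := tensor_sum x.
by apply: big_ind => //; rewrite -(tmul0l 0); apply: Pt.
Qed.

(** The [A]-linear map [id (x) f]. These maps replace the choice of a basis of [H]. *)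
Definition contract (f : {linear H -> k^o}) (x : tensor A H) : A :=
  tens_sum (fun a h => f h *: a) (repr (x : {eq_quot tens_equiv A H})).

Section One.
Variable f : {linear H -> k^o}.

Lemma contract_class s :
  contract f (tens_class s) = tens_sum (fun a h => f h *: a) s.
Proof.
apply: (@tens_rel_sum _ _ _ A) (tens_repr s) => [b|a] c u v /=.
  by rewrite scalerDr !scalerA mulrC.
by rewrite linearP scalerDl -scalerA.
Qed.

Lemma contract_tmul a h : contract f (tmul a h) = f h *: a.
Proof. by rewrite contract_class /tens_sum big_seq1. Qed.

Fact contract_zmod : zmod_morphism (contract f).
Proof.
elim/tens_ind=> s; elim/tens_ind=> t.
have -> : tens_class s - tens_class t
  = tens_class (s ++ [seq (- p.1, p.2) | p <- t]) :> tensor A H.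
  by rewrite -tens_addE -tens_oppE.
rewrite !contract_class /tens_sum big_cat big_map /=; congr (_ + _).
by rewrite -sumrN; apply: eq_bigr => p _; rewrite scalerN.
Qed.
HB.instance Definition _ :=
  GRing.isZmodMorphism.Build (tensor A H) A (contract f) contract_zmod.

Lemma contractM a x : contract f (tens_inl _ a * x) = a * contract f x.
Proof.
elim/tensor_indP: x => [b h|x y hx hy]; last by rewrite mulrDr !raddfD /= mulrDr hx hy.
by rewrite /tens_inl tmulM mul1r !contract_tmul scalerAr.
Qed.
End One.

(** Induction on the number of terms. If the first [h] is a combination of the others, the terms
    merge; otherwise a functional that vanishes on the others and is 1 on the first shows that the
    first [a] is zero. *)
Lemma contract_inj (x : tensor A H) :
  (forall f : {linear H -> k^o}, contract f x = 0) -> x = 0.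
Proof.
have [n [a [h xE]]] := tensor_sum x.
elim: n => [|n IHn] in x a h xE *; first by rewrite xE big_ord0.
move=> x0; pose W : set H := fun v => exists c : 'I_n -> k, v = \sum_(i < n) c i *: h (lift ord0 i).
have [[c hE]|nW] := pselect (W (h ord0)).
  apply: (IHn _ (fun i => a (lift ord0 i) + c i *: a ord0) (h \o lift ord0)) x0.
  rewrite xE big_ord_recl hE /=.
  under [RHS]eq_bigr do rewrite tmulDl.
  rewrite big_split /= addrC; congr (_ + _).
  under [RHS]eq_bigr do rewrite tmulZl -tmulZr.
  have tmul_sum b (F : 'I_n -> H) : tmul b (\sum_i F i) = \sum_i tmul b (F i) :> tensor A H.
    by apply: (big_morph (tmul b) (tmulDr b) (tmul0r b)).
  exact: tmul_sum.
have subW : submodule W.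
  split=> [|d _ _ [c ->] [e ->]].
    by exists (fun=> 0); rewrite big1// => i _; rewrite scale0r.
  exists (fun i => d * c i + e i); rewrite scaler_sumr -big_split.
  by apply: eq_bigr => i _; rewrite scalerDl scalerA.
have [f [fW fh]] := separating_functional subW nW.
have a0 : a ord0 = 0.
  rewrite -(x0 f) xE raddf_sum big_ord_recl big1 ?addr0 /=.
    by rewrite contract_tmul fh scale1r.
  move=> i _; rewrite contract_tmul fW ?scale0r//.
  exists (fun j => (j == i)%:R); rewrite (bigD1 i)//= eqxx scale1r big1 ?addr0//.
  by move=> j /negPf ->; rewrite scale0r.
apply: (IHn x (a \o lift ord0) (h \o lift ord0)) => //.
by rewrite xE big_ord_recl a0 tmul0l add0r.
Qed.

End Contraction.

Lemma tens_map_tmul (k : fieldType) (A B C D : comAlgType k)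
    (f : {lrmorphism A -> C}) (g : {lrmorphism B -> D}) a b :
  tens_map f g (tmul a b) = tmul (f a) (g b).
Proof.
rewrite [LHS]tens_lift_tmul /= /tens_inl /tens_inr.
by rewrite tmulM mulr1 mul1r.
Qed.

Lemma tensor_ext (k : fieldType) (A B : comAlgType k) (V : zmodType)
    (f f' : {additive tensor A B -> V}) :
  (forall a b, f (tmul a b) = f' (tmul a b)) -> f =1 f'.
Proof.
by move=> ff'; elim/tensor_indP => // x y hx hy; rewrite !raddfD hx hy.
Qed.

Lemma tens_inlMinr (k : fieldType) (A B : comAlgType k) (a : A) (b : B) :
  tens_inl B a * tens_inr A b = tmul a b.
Proof. by rewrite /tens_inl /tens_inr tmulM mulr1 mul1r. Qed.

(** * Noetherian rings *)

Section Span.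
Variable R : comNzRingType.
Implicit Types (f : nat -> R) (p q : R).

Definition span_below f n p : Prop := exists c : nat -> R, p = \sum_(i < n) c i * f i.

(** Equivalent to the ascending chain condition on ideals. It is phrased with one sequence because
    Hilbert's basis theorem and Krull's theorem use it in that form. *)
Definition noetherian : Prop := forall f, exists n, span_below f n (f n).

Lemma span_below0 f n : span_below f n 0.
Proof. by exists (fun=> 0); rewrite big1// => i _; rewrite mul0r. Qed.

Lemma span_belowDM f n a p q :
  span_below f n p -> span_below f n q -> span_below f n (p + a * q).
Proof.
move=> [c ->] [d ->]; exists (fun i => c i + a * d i).
by rewrite mulr_sumr -big_split; apply: eq_bigr => i _; rewrite mulrDl mulrA.
Qed.

Lemma span_below_sum f n m (c : nat -> R) g :
  (forall i, (i < m)%N -> span_below f n (g i)) ->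
  span_below f n (\sum_(i < m) c i * g i).
Proof.
move=> fg; elim: m => [|m IHm] in fg *; first by rewrite big_ord0; apply: span_below0.
rewrite big_ord_recr /=; apply: span_belowDM; last exact: fg.
by apply: IHm => i im; apply: fg; apply: ltnW.
Qed.

Lemma span_below_mem f n i : (i < n)%N -> span_below f n (f i).
Proof.
move=> lt_in; exists (fun j => (j == i)%:R); rewrite (bigD1 (Ordinal lt_in))//=.
by rewrite eqxx mul1r big1 ?addr0// => j; rewrite -val_eqE /= => /negPf ->; rewrite mul0r.
Qed.

Lemma span_belowW f n m p : (n <= m)%N -> span_below f n p -> span_below f m p.
Proof.
move=> nm [c ->]; apply: span_below_sum => i lt_in.
by apply: span_below_mem; apply: leq_trans nm.
Qed.

End Span.

Lemma noetherian_surj (R R' : comNzRingType) (s : {rmorphism R -> R'}) :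
  (forall y, exists x, s x = y) -> noetherian R -> noetherian R'.
Proof.
move=> surj nR f; pose g i := sval (cid (surj (f i))).
have sg i : s (g i) = f i by rewrite /g; case: cid.
have [n [c gE]] := nR g; exists n, (s \o c); rewrite -sg gE rmorph_sum.
by apply: eq_bigr => i _; rewrite rmorphM /= sg.
Qed.

Lemma noetherian_field (F : fieldType) : noetherian F.
Proof.
move=> f; have [f0|f0] := eqVneq (f 0) 0.
  by exists 0, (fun=> 0); rewrite big_ord0.
by exists 1, (fun=> f 1 / f 0); rewrite big_ord1 divfK.
Qed.

Section HilbertBasis.
Variables (R : comNzRingType) (nR : noetherian R) (f : nat -> {poly R}).
Hypothesis not_span : forall n, ~ span_below f n (f n).
Implicit Types (p q : {poly R}) (s : seq {poly R}).

Let I p : Prop := exists n, span_below f n p.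

Let IDM a p q : I p -> I q -> I (p + a * q).
Proof.
move=> [n fp] [m fq]; exists (maxn n m); apply: span_belowDM.
  exact: span_belowW (leq_maxl _ _) fp.
exact: span_belowW (leq_maxr _ _) fq.
Qed.

Let spans s := span_below (nth 0 s) (size s).

Let minimal_new s p : Prop :=
  [/\ I p, ~ spans s p & forall q, I q -> ~ spans s q -> (size p <= size q)%N].

(** The condition on [s] stands under the existential so that the choice [sel] is a total function
    of lists. *)
Let minimal_new_ex s : exists p, (forall q, q \in s -> I q) -> minimal_new s p.
Proof.
have [sI|] := pselect (forall q, q \in s -> I q); last by exists 0.
suff [p [Ip np]] : exists p, I p /\ ~ spans s p.
  have ex : exists n, `[< exists q, [/\ I q, ~ spans s q & size q = n] >].
    by exists (size p); apply/asboolP; exists p.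
  case: (ex_minnP ex) => n /asboolP[q [Iq nq <-]] min; exists q => _.
  by split=> // r Ir nr; apply: min; apply/asboolP; exists r.
have [N fN] : exists N, forall q, q \in s -> span_below f N q.
  elim: s sI => [|q s IHs] sI; first by exists 0.
  have [|N fN] := IHs; first by move=> r rs; apply: sI; rewrite inE rs orbT.
  have [M fM] := sI q (mem_head _ _); exists (maxn N M) => r.
  rewrite inE => /orP[/eqP ->|/fN]; first exact: span_belowW (leq_maxr _ _) fM.
  exact: span_belowW (leq_maxl _ _).
exists (f N); split; first by exists N.+1; apply: span_below_mem.
move=> [c fNE]; apply: (not_span (n := N)); rewrite fNE.
by apply: span_below_sum => i lt_is; apply/fN/mem_nth.
Qed.

Let sel s := sval (cid (minimal_new_ex s)).
Let prefix n := iter n (fun s => rcons s (sel s)) [::].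
Let g n := sel (prefix n).

Let size_prefix n : size (prefix n) = n.
Proof. by elim: n => //= n IHn; rewrite size_rcons IHn. Qed.

Let nth_prefix n i : (i < n)%N -> nth 0 (prefix n) i = g i.
Proof.
elim: n => //= n IHn; rewrite ltnS leq_eqVlt nth_rcons size_prefix.
by case/orP=> [/eqP->|lt_in]; [rewrite ltnn eqxx | rewrite lt_in IHn].
Qed.

Let spans_prefix n p : spans (prefix n) p <-> span_below g n p.
Proof.
by split=> -[c ->]; exists c; rewrite size_prefix; apply: eq_bigr => i _;
  rewrite nth_prefix.
Qed.

Let gP n : minimal_new (prefix n) (g n).
Proof.
have selP s : (forall q, q \in s -> I q) -> minimal_new s (sel s).
  by rewrite /sel; case: cid.
apply: (selP); elim: n => //= n IHn q; rewrite mem_rcons inE => /orP[/eqP->|/IHn//].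
by have [] := selP _ IHn.
Qed.

(** Each [g n] has minimal size among the elements of [I] outside the ideal of its predecessors. A
    relation between leading coefficients yields [h] in [I], still outside that ideal, of smaller
    size than [g n]. *)
Lemma hilbert_contradiction : False.
Proof.
have gI n : I (g n) by have [] := gP n.
have g_new n : ~ span_below g n (g n) by have [_ + _] := gP n; rewrite spans_prefix.
have g_min n q : I q -> ~ span_below g n q -> (size (g n) <= size q)%N.
  by have [_ _ +] := gP n => /[apply] + nq; apply; rewrite spans_prefix.
have [n [c gn]] := nR (fun i => lead_coef (g i)).
have le_size (i : 'I_n) : (size (g i) <= size (g n))%N.
  apply: g_min => // gni; apply: (g_new n); apply: span_belowW gni.
  exact: ltnW.
have gn0 : g n != 0 by apply/eqP => g0; apply: (g_new n); rewrite g0; apply: span_below0.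
(* The power of ['X] raises [g i] to the size of [g n], so that the leading terms meet. *)
pose a i : {poly R} := c i *: 'X^(size (g n) - size (g i)).
have [h hE] : exists h, h = g n - \sum_(i < n) a i * g i by eexists.
have aI m : I (\sum_(i < m) a i * g i).
  elim: m => [|m IHm]; first by rewrite big_ord0; exists 0; apply: span_below0.
  by rewrite big_ord_recr /=; apply: IDM.
have nh : ~ span_below g n h.
  move=> hs; apply: (g_new n); rewrite -[g n](subrK (\sum_(i < n) a i * g i)) -hE.
  rewrite -[X in _ + X]mul1r; apply: span_belowDM => //.
  by apply: span_below_sum => i; apply: span_below_mem.
have Ih : I h by rewrite hE -mulN1r; apply: IDM.
have := g_min n h Ih nh; apply/negP; rewrite -ltnNge.
rewrite -(@prednK (size (g n))) ?lt0n ?size_poly_eq0// ltnS.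
apply/leq_sizeP => j le_j; rewrite hE coefB coef_sum.
have aE (i : 'I_n) : (a i * g i)`_j =
    c i * (if (j < size (g n) - size (g i))%N then 0
           else (g i)`_(j - (size (g n) - size (g i)))).
  by rewrite /a -scalerAl coefZ coefXnM.
under eq_bigr do rewrite aE.
(* In the top degree the relation [gn] cancels the coefficients; above it all of them are zero. *)
case: (ltngtP j (size (g n)).-1) le_j => // [lt_j|->] _; last first.
  rewrite -/(lead_coef (g n)) gn -sumrB big1// => i _.
  have gi0 : (0 < size (g i))%N.
    rewrite lt0n size_poly_eq0; apply/eqP => g0; apply: (g_new i).
    by rewrite g0; apply: span_below0.
  have -> : ((size (g n)).-1 < size (g n) - size (g i))%N = false.
    by have := le_size i; lia.
  have -> : ((size (g n)).-1 - (size (g n) - size (g i)))%N = (size (g i)).-1.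
    by have := le_size i; lia.
  by rewrite subrr.
have szn : (size (g n) <= j)%N by lia.
rewrite nth_default// big1 ?subr0// => i _.
rewrite nth_default ?if_same ?mulr0//.
by rewrite -{1}(subKn (le_size i)) leq_sub2r.
Qed.

End HilbertBasis.

Lemma noetherian_poly (R : comNzRingType) : noetherian R -> noetherian {poly R}.
Proof.
move=> nR f; apply: contrapT => /forallNP nf.
exact: (hilbert_contradiction nR nf).
Qed.

(** Induction on [n]: substituting ['X_ord_max] maps [{poly {mpoly R[n]}}] onto [{mpoly R[n.+1]}],
    and a quotient of a noetherian ring is noetherian. *)
Lemma noetherian_mpoly (R : comNzRingType) n : noetherian R -> noetherian {mpoly R[n]}.
Proof.
move=> nR; elim: n => [|n IHn].
  apply: (noetherian_surj (s := @mpolyC 0 R)) nR => p.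
  exists p@_0; apply/mpolyP => m; rewrite mcoeffC.
  have -> : m = 0%MM by apply/mnmP => -[].
  by rewrite eqxx mulr1.
pose s p : {mpoly R[n.+1]} := (map_poly (@mwiden n R) p).['X_ord_max].
have sM : {morph s : p q / p * q} by move=> p q; rewrite /s rmorphM hornerM.
have sD : {morph s : p q / p - q} by move=> p q; rewrite /s rmorphB hornerD hornerN.
have s1 : s 1 = 1 by rewrite /s rmorph1 hornerC.
pose F1 := GRing.isZmodMorphism.Build _ _ s sD.
pose F2 := GRing.isMonoidMorphism.Build _ _ s (s1, sM).
pose sR : {rmorphism {poly {mpoly R[n]}} -> {mpoly R[n.+1]}} := HB.pack s F1 F2.
apply: (noetherian_surj (s := sR)) (noetherian_poly IHn) => q.
elim/mpolyind: q => [|c m p _ _ [p' <-]]; first by exists 0; rewrite rmorph0.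
have [x sx] : exists x, sR x = 'X_[m].
  exists ('X_[[multinom m (widen_ord (leqnSn n) i) | i < n]]%:P * 'X^(m ord_max)).
  rewrite rmorphM rmorphXn /= /s map_polyC map_polyX hornerC hornerX.
  rewrite -[X in X * _]/(mwiden _) /mwiden mmapX [RHS]mpolyXE_id big_ord_recr /=; congr (_ * _).
  by apply: eq_bigr => i _; rewrite mnmE.
exists (c%:MP%:P * x + p'); rewrite rmorphD rmorphM sx; congr (_ + _).
by rewrite /= /s map_polyC hornerC /= mwidenC mul_mpolyC.
Qed.

(** * Smooth algebras over a field are geometrically reduced *)

Lemma coefM_low (D : comNzRingType) (p q : {poly D}) d d' :
  (forall j, (j < d)%N -> p`_j = 0) -> (forall j, (j < d')%N -> q`_j = 0) ->
  forall j, (j < d + d')%N -> (p * q)`_j = 0.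
Proof.
move=> lp lq j lt_j; rewrite coefM big1//= => i _.
have [lt_id|le_di] := ltnP i d; first by rewrite lp ?mul0r.
by rewrite lq ?mulr0//; have := ltn_ord i; lia.
Qed.

(** If [v] is the lowest exponent of [r], the coefficient of [r ^+ e] at [e * v] is the [e]-th power
    of a nonzero element of a domain. *)
Lemma poly_low_exp (D : idomainType) (r : {poly D}) e d : (0 < e)%N ->
  (forall j, (j < e * d)%N -> (r ^+ e)`_j = 0) -> forall j, (j < d)%N -> r`_j = 0.
Proof.
move=> e0 re j lt_jd; apply/eqP; apply: contraT => rj.
have ex : exists v, r`_v != 0 by exists j.
case: (ex_minnP ex) => v rv vmin.
have rE : r = drop_poly v r * 'X^v.
  rewrite -[LHS](poly_take_drop v) (_ : take_poly v r = 0) ?add0r//.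
  apply/polyP => i; rewrite coef_take_poly coef0; case: ifP => // lt_iv.
  by apply/eqP; apply: contraTT lt_iv => /vmin; rewrite -leqNgt.
have lt_vd : (v < d)%N by apply: leq_ltn_trans (vmin _ rj) lt_jd.
have := re (e * v)%N; rewrite ltn_pmul2l// => /(_ lt_vd)/eqP.
rewrite rE exprMn -exprM mulnC coefMXn ltnn subnn.
rewrite -horner_coef0 hornerE expf_eq0 e0 horner_coef0 coef_drop_poly add0n.
by rewrite (negPf rv).
Qed.

(** * Order of vanishing of a polynomial at the origin *)

Section Order.
Variables (L : fieldType) (n : nat).
Implicit Types (p q : {mpoly L[n]}).

(* [p] lies in the [d]-th power of the ideal of the origin. *)
Definition low d p : Prop := forall m : 'X_{1..n}, (mdeg m < d)%N -> p@_m = 0.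

(* The substitution ['X_i |-> 'X_i T]: it turns the order of vanishing at the
   origin into divisibility by a power of [T]. *)
Definition homog_split : {mpoly L[n]} -> {poly {mpoly L[n]}} :=
  mmap (polyC \o @mpolyC n L) (fun i => 'X_i *: 'X).
HB.instance Definition _ := GRing.RMorphism.on homog_split.

Lemma homog_splitE p :
  homog_split p = \sum_(m <- msupp p) (p@_m *: 'X_[m]) *: 'X^(mdeg m).
Proof.
apply: eq_bigr => m _; rewrite /mmap1 /=.
under eq_bigr do rewrite exprZn.
rewrite scaler_prod prodrXr -mpolyXE_id -mdegE mul_polyC.
by rewrite scalerA mul_mpolyC.
Qed.

Lemma coef_homog_split p m : ((homog_split p)`_(mdeg m))@_m = p@_m.
Proof.
rewrite homog_splitE coef_sum raddf_sum /=.
under eq_bigr => m' _ do rewrite coefZ coefXn mulr_natr mcoeffMn mcoeffZ mcoeffX.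
have [mp|mp] := boolP (m \in msupp p); last first.
  rewrite (memN_msupp_eq0 mp) big1_seq// => m' /= m'p.
  have [mm'|_] := eqVneq m' m; first by rewrite mm' (negPf mp) in m'p.
  by rewrite mulr0 mul0rn.
rewrite (bigD1_seq m)//= ?msupp_uniq// !eqxx mulr1 mulr1n big1 ?addr0//.
by move=> m' /negPf ->; rewrite mulr0 mul0rn.
Qed.

Lemma lowP d p : low d p <-> forall j, (j < d)%N -> (homog_split p)`_j = 0.
Proof.
split=> [lp j lt_jd|hp m lt_md]; last first.
  by rewrite -coef_homog_split hp// mcoeff0.
rewrite homog_splitE coef_sum big1_seq//= => m _; rewrite coefZ coefXn.
have [jm|_] := eqVneq j (mdeg m); last by rewrite mulr0.
by rewrite lp -?jm// scale0r mul0r.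
Qed.

Lemma low0 d : low d 0.
Proof. by move=> m _; rewrite mcoeff0. Qed.

Lemma lowD d p q : low d p -> low d q -> low d (p + q).
Proof. by move=> lp lq m lt_m; rewrite mcoeffD lp ?lq ?addr0. Qed.

Lemma lowW d d' p : (d <= d')%N -> low d' p -> low d p.
Proof. by move=> dd' lp m lt_m; apply: lp; apply: leq_trans dd'. Qed.

Lemma lowM d d' p q : low d p -> low d' q -> low (d + d') (p * q).
Proof.
move=> /lowP lp /lowP lq; apply/lowP => j; rewrite (rmorphM homog_split).
exact: coefM_low.
Qed.

(** [homog_split] transfers the question to one-variable polynomials over the domain [{mpoly
    L[n]}]. *)
Lemma low_exp p e d : (0 < e)%N -> low (e * d) (p ^+ e) -> low d p.
Proof.
move=> e0 /lowP pe; apply/lowP; apply: poly_low_exp e0 _ => j /pe.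
by rewrite (rmorphXn homog_split).
Qed.

End Order.

(** * Krull's intersection theorem by way of the Rees algebra *)

Section KrullIntersection.
Variables (L : fieldType) (A : comNzRingType) (n : nat).
Variables (c : {rmorphism L -> A}) (e : {rmorphism A -> L}) (x : 'I_n -> A).
Hypothesis ex0 : forall i, e (x i) = 0.

Let pi : {mpoly L[n]} -> A := mmap c x.
HB.instance Definition _ := GRing.RMorphism.on pi.

(* The image of this map is the Rees algebra of the ideal generated by [x]. *)
Definition rees : {mpoly {mpoly L[n]}[n]} -> {poly A} :=
  mmap (polyC \o pi) (fun i => x i *: 'X).
HB.instance Definition _ := GRing.RMorphism.on rees.

Let reesC p : rees p%:MP = (pi p)%:P.
Proof. exact: mmapC. Qed.

Let reesX i : rees 'X_i = x i *: 'X.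
Proof. by rewrite /rees mmapX mmap1U. Qed.

Let reesM : {morph rees : p q / p * q}. Proof. exact: rmorphM. Qed.
Let reesD : {morph rees : p q / p + q}. Proof. exact: rmorphD. Qed.
Let piM : {morph pi : p q / p * q}. Proof. exact: rmorphM. Qed.
Let piD : {morph pi : p q / p + q}. Proof. exact: rmorphD. Qed.

Let rees_sum m (F : 'I_m -> {mpoly {mpoly L[n]}[n]}) :
  rees (\sum_(i < m) F i) = \sum_(i < m) rees (F i).
Proof. exact: rmorph_sum. Qed.

Let piX i : pi 'X_i = x i.
Proof. by rewrite /pi mmapX mmap1U. Qed.

(** A monomial of degree at least [d] gives up one variable for each of [d] factors [x i *: 'X]; the
    rest of it enters as a coefficient. *)
Let rees_lift d p : low d p -> exists b, rees b = pi p *: 'X^d.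
Proof.
have liftX m : (d <= mdeg m)%N -> exists b, rees b = pi 'X_[m] *: 'X^d.
  elim: d m => [|d IHd] m le_dm.
    by exists ('X_[m])%:MP; rewrite reesC expr0 alg_polyC.
  have [i mi] : exists i, m i != 0%N.
    apply/existsP; apply: contraTT le_dm => /existsPn m0.
    by rewrite (_ : m = 0%MM) ?mdeg0//; apply/mnmP => i; have := m0 i; rewrite negbK mnm0E => /eqP.
  have mE : m = (U_(i) + (m - U_(i)))%MM.
    rewrite addmC submK//; apply/mnm_lepP => j; rewrite mnm1E.
    by case: eqP => // <-; rewrite lt0n.
  have [|b bE] := IHd (m - U_(i))%MM.
    by have := congr1 (@mdeg n) mE; rewrite mdegD mdeg1; lia.
  exists ('X_i * b); rewrite reesM bE reesX [in RHS]mE mpolyXD piM piX.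
  by rewrite exprS -scalerAl -scalerAr scalerA.
elim/mpolyind: p => [|a m p mp a0 IHp] lp; first by exists 0; rewrite !rmorph0 scale0r.
have mpE m' : (a *: 'X_[m] + p)@_m' = if m' == m then a else p@_m'.
  rewrite mcoeffD mcoeffZ mcoeffX eq_sym; case: eqP => [->|_]; last by rewrite mulr0 add0r.
  by rewrite mulr1 memN_msupp_eq0 ?addr0.
have [b bE] : exists b, rees b = pi 'X_[m] *: 'X^d.
  apply: liftX; rewrite leqNgt; apply: contra_neqN a0 => lt_md.
  by have := lp m lt_md; rewrite mpE eqxx.
have [b' b'E] : exists b, rees b = pi p *: 'X^d.
  apply: IHp => m' lt_m'; have := lp m' lt_m'; rewrite mpE; case: eqP => // -> _.
  exact: memN_msupp_eq0.
exists (a%:MP%:MP * b + b'); rewrite reesD reesM bE b'E reesC.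
by rewrite -mul_mpolyC piD piM scalerDl mul_polyC scalerA.
Qed.

Let rees_coef b j : (0 < j)%N -> e (rees b)`_j = 0.
Proof.
have -> : rees b = \sum_(m <- msupp b) (pi b@_m)%:P * \prod_(i < n) (x i *: 'X) ^+ m i by [].
move=> j0; rewrite coef_sum rmorph_sum big1//= => m _; rewrite coefCM rmorphM /=.
under eq_bigr do rewrite exprZn.
rewrite scaler_prod coefZ prodrXr -mdegE coefXn.
have [jm|] := eqVneq j (mdeg m); last by rewrite mulr0 rmorph0 mulr0.
have [i mi] : exists i, m i != 0%N.
  apply/existsP; apply: contraTT j0 => /existsPn m0.
  rewrite jm (_ : m = 0%MM) ?mdeg0//.
  by apply/mnmP => i; have := m0 i; rewrite negbK mnm0E => /eqP.
rewrite mulr1 (bigD1 i)//= rmorphM rmorphXn /= ex0 expr0n (negPf mi).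
by rewrite mul0r mulr0.
Qed.

(** Every [y *: 'X^d] lies in the Rees algebra, a quotient of a noetherian polynomial ring. So some
    [y *: 'X^m] is a combination of the [y *: 'X^i] with [i < m]. The coefficient at ['X^m] reads
    [y = a * y], where [a] collects coefficients of positive degree [m - i], which [e] kills. *)
Lemma krull_intersection (y : A) :
  (forall d, exists p, low d p /\ mmap c x p = y) -> exists a, e a = 0 /\ y = a * y.
Proof.
move=> yP.
have yL d : exists b, rees b = y *: 'X^d.
  by have [p [lp <-]] := yP d; apply: rees_lift.
pose f d := sval (cid (yL d)).
have fE d : rees (f d) = y *: 'X^d by rewrite /f; case: cid.
have nB : noetherian {mpoly {mpoly L[n]}[n]}.
  by do 2!apply: noetherian_mpoly; apply: noetherian_field.
have [m [g fm]] := nB f.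
exists (\sum_(i < m) (rees (g i))`_(m - i)); split.
  by rewrite rmorph_sum big1// => i _; apply: rees_coef; rewrite subn_gt0.
have := congr1 (fun p => (rees p)`_m) fm.
rewrite fE coefZ coefXn eqxx mulr1 => {1}->.
rewrite rees_sum coef_sum mulr_suml; apply: eq_bigr => i _.
by rewrite reesM fE -scalerAr coefZ coefMXn ltnNge ltnW//= mulrC.
Qed.

End KrullIntersection.

(** The second conclusion reduces the claim that the kernel of [f] has square zero to the claim that
    products of two elements of [J] lie in [I]. *)
Lemma quo_idealW (k : fieldType) (B : comAlgType k) (I J : {pred B})
    (hI : idealr_closed I) (hJ : idealr_closed J) :
  {subset I <= J} ->
  exists2 f : {lrmorphism quo hI -> quo hJ},
    forall x, f (quo_pi hI x) = quo_pi hJ x &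
    (forall y z, f y = 0 -> f z = 0 ->
       exists a b, [/\ a \in J, b \in J, quo_pi hI a = y & quo_pi hI b = z]).
Proof.
move=> IJ; have piJ x : x \in J <-> quo_pi hJ x = 0.
  by rewrite -(rmorph0 (quo_pi hJ)) quo_piP subr0.
have [|f fE] := quo_factor hI (f := quo_pi hJ); first by move=> x /IJ/piJ.
exists f => // y z; have [a <-] := quo_pi_surj y; have [b <-] := quo_pi_surj z.
by rewrite !fE => /piJ aJ /piJ bJ; exists a, b.
Qed.

(** * Nilpotent elements near a rational point of a smooth algebra *)

Section RationalPoint.
Variables (k : fieldType) (H L0 : comAlgType k) (hL : field_prop L0).
Local Notation L := (field_alg hL).
Variables (q : {lrmorphism H -> L}) (s : seq H).
Hypothesis gen : forall U : {pred H},
  GRing.subalg_closed U -> {subset s <= U} -> forall a, a \in U.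
Hypothesis smooth : formally_smooth H.

Local Notation A := (tensor L H).
Local Notation n := (size s).
Local Notation inl := (@tens_inl k L H).
Local Notation inr := (@tens_inr k L H).

Let e : {lrmorphism A -> L} := tens_lift idfun q.
(** Coordinates centred at the rational point [e]. *)
Let x (i : 'I_n) : A := inr s`_i - inl (q s`_i).

Let e_inl a : e (inl a) = a.
Proof. by rewrite /e /= tens_lift_tmul rmorph1 mulr1. Qed.

Let ex0 i : e (x i) = 0.
Proof.
rewrite rmorphB; apply/eqP; rewrite subr_eq0; apply/eqP; rewrite [RHS]e_inl.
by rewrite /= tens_lift_tmul rmorph1 mul1r.
Qed.

Let iota : {rmorphism k -> {mpoly L[n]}} := @mpolyC n L \o in_alg L.
(** Formal smoothness of [H] concerns [k]-algebras, so the polynomial ring over [L] gets scalars in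
    [k]. *)
Let P := restr_alg iota.
Let pi (p : P) : A := mmap inl x (p : {mpoly L[n]}).

Let pi_monoid : monoid_morphism pi.
Proof. by split; [exact: (rmorph1 (mmap inl x)) | exact: (rmorphM (mmap inl x))]. Qed.
Let pi_linear : linear pi.
Proof.
move=> c p r; rewrite -[LHS]/(mmap inl x (iota c * p + r)).
rewrite rmorphD rmorphM /= mmapC.
congr (_ + _); have cA : inl (c%:A : L) = c *: (1 : A) by rewrite /tens_inl tmulZl.
by rewrite -[pi p in RHS]mul1r scalerAl; congr (_ * _); apply: cA.
Qed.
HB.instance Definition _ := GRing.isLinear.Build k P A *:%R pi pi_linear.
HB.instance Definition _ := GRing.isMonoidMorphism.Build P A pi pi_monoid.


Let piM : {morph pi : p r / p * r}. Proof. exact: rmorphM. Qed.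
Let piD : {morph pi : p r / p + r}. Proof. exact: rmorphD. Qed.
Let piB : {morph pi : p r / p - r}. Proof. exact: rmorphB. Qed.
Let piP c p r : pi (c *: p + r) = c *: pi p + pi r. Proof. exact: linearP. Qed.
Let pi1 : pi 1 = 1. Proof. exact: rmorph1. Qed.
Let pi0 : pi 0 = 0. Proof. exact: rmorph0. Qed.

Let piC a : pi a%:MP_[n] = inl a.
Proof. exact: mmapC. Qed.

Let piX i : pi 'X_i = x i.
Proof. by rewrite /pi mmapX mmap1U. Qed.

Let pi_surj z : exists p, pi p = z.
Proof.
have inrH h : exists p, pi p = inr h.
  pose U : {pred H} := fun h => `[< exists p, pi p = inr h >].
  apply/asboolP; apply: (gen (U := U)) => [|h' hs].
    split=> [|c u v /asboolP[a ua] /asboolP[b vb]|u v /asboolP[a ua] /asboolP[b vb]].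
    - by apply/asboolP; exists 1; rewrite pi1.
    - by apply/asboolP; exists (c *: a + b); rewrite piP ua vb [RHS]linearP.
    - by apply/asboolP; exists (a * b); rewrite piM ua vb [RHS]rmorphM.
  apply/asboolP; have lt_h : (index h' s < n)%N by rewrite index_mem.
  pose i := Ordinal lt_h.
  exists (('X_i : P) + ((q s`_i)%:MP_[n] : P)).
  by rewrite piD piX piC subrK nth_index.
elim/tensor_indP: z => [a h|z t [p <-] [r <-]]; last by exists (p + r); rewrite piD.
have [p pE] := inrH h; exists ((a%:MP_[n] : P) * p).
by rewrite piM piC pE /tens_inl /tens_inr tmulM mul1r mulr1.
Qed.

Let e_pi p : e (pi p) = (p : {mpoly L[n]})@_0.
Proof.
elim/mpolyind: p => [|a m p _ _ IHp]; first by rewrite pi0 rmorph0 mcoeff0.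
have eX : e (pi ('X_[m] : P)) = (m == 0%MM)%:R.
  rewrite /pi mmapX; have [->|m0] := eqVneq m 0%MM; first by rewrite mmap11 rmorph1.
  have [i mi] : exists i, m i != 0%N.
    apply/existsP; apply: contraNT m0 => /existsPn m0.
    by apply/eqP/mnmP => i; have := m0 i; rewrite negbK mnm0E => /eqP.
  have exm : e (x i ^+ m i) = 0 by rewrite rmorphXn [X in X ^+ _]ex0 expr0n (negPf mi).
  rewrite (_ : mmap1 x m = x i ^+ m i * \prod_(j | j != i) x j ^+ m j).
    by rewrite rmorphM [X in X * _]exm mul0r.
  exact: bigD1.
rewrite -mul_mpolyC mcoeffD mcoeffCM mcoeffX -IHp -eX -[a in RHS]e_inl.
by rewrite piD piM piC rmorphD rmorphM.
Qed.

(* Intersecting the kernel of [pi] with the powers of the maximal ideal of the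
   origin makes the kernel of [P / J d.+2 -> P / J d.+1] of square zero. *)
Let J d : {pred P} := fun p => `[< pi p = 0 /\ low d (p : {mpoly L[n]}) >].

Let hJ d : idealr_closed (J d).
Proof.
split=> [||a u v /asboolP[u0 lu] /asboolP[v0 lv]]; apply/asboolP.
- by split; [exact: pi0|exact: low0].
- by case=> /eqP; rewrite pi1 oner_eq0.
split; first by rewrite piD piM u0 v0 mulr0 addr0.
by apply: lowD => //; rewrite -[d]add0n; apply: lowM.
Qed.

(** Induction on [d]. By [e_pi] the kernel of [pi] has no constant terms, so [J 1] is the whole
    kernel and [P / J 1] is [A]: there [inr] itself serves. Each further step lifts along a
    square-zero extension by formal smoothness. *)
Let lift_quo d : exists f : {lrmorphism H -> quo (hJ d.+1)},
  forall h p, f h = quo_pi (hJ d.+1) p -> pi p = inr h.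
Proof.
elim: d => [|d [f fP]].
  pose lift h : P := sval (cid (pi_surj (inr h))).
  have piE p r : pi p = pi r -> quo_pi (hJ 1) p = quo_pi (hJ 1) r.
    move=> pr; apply/quo_piP/asboolP; rewrite piB pr subrr; split=> // m.
    rewrite ltnS leqn0 mdeg_eq0 => /eqP ->.
    by rewrite -e_pi piB pr subrr rmorph0.
  have liftE h : pi (lift h) = inr h by rewrite /lift; case: cid.
  pose f h := quo_pi (hJ 1) (lift h).
  have flin : linear f.
    by move=> c u v; rewrite /f -linearP; apply: piE; rewrite piP !liftE [LHS]linearP.
  have fmon : monoid_morphism f.
    split=> [|u v]; rewrite /f -?rmorphM -?(rmorph1 (quo_pi (hJ 1))); apply: piE.
      by rewrite liftE pi1 rmorph1.
    by rewrite piM !liftE [LHS]rmorphM.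
  pose G1 := GRing.isLinear.Build _ _ _ _ f flin.
  pose G2 := GRing.isMonoidMorphism.Build _ _ f fmon.
  pose fl : {lrmorphism H -> quo (hJ 1)} := HB.pack f G1 G2.
  exists fl => h p /quo_piP/asboolP[+ _]; rewrite piB liftE => /eqP.
  by rewrite subr_eq0 => /eqP.
have [|g gE gK] := quo_idealW (hJ d.+2) (hJ d.+1).
  move=> p /asboolP[p0 lp]; apply/asboolP; split=> //.
  by apply: lowW lp.
have [||f' f'E] := smooth (p := g) _ _ f.
- by move=> c; have [p <-] := quo_pi_surj c; exists (quo_pi (hJ d.+2) p).
- move=> y z y0 z0; have [a [b [/asboolP[a0 la] /asboolP[b0 lb] <- <-]]] := gK _ _ y0 z0.
  rewrite -rmorphM -(rmorph0 (quo_pi (hJ d.+2))); apply/quo_piP; rewrite subr0.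
  apply/asboolP; split; first by rewrite piM a0 mul0r.
  (* Twice [d.+1] is at least [d.+2]. *)
  by apply: lowW (lowM la lb); rewrite addSnnS leq_addl.
by exists f' => h p f'h; apply: fP; rewrite -f'E f'h gE.
Qed.

(** The lift [f] and the constants give a section of [P / J -> A]. It sends [z] to the class of a
    polynomial [p] with [p ^+ m] in [J], so [p] vanishes to high order and [z = pi p] meets the
    hypothesis of Krull's theorem. *)
Lemma nilpotent_krull (z : A) m : z ^+ m = 0 -> exists a, e a = 0 /\ z = a * z.
Proof.
move=> zm0; have [m0|m0] := posnP m.
  by move: zm0; rewrite m0 expr0 => /eqP; rewrite oner_eq0.
refine (@krull_intersection L A n inl e x ex0 z _) => d.
(* Order [m * d] for [p ^+ m] means order [d] for [p]. *)
have [f fP] := lift_quo (m * d).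
set hQ := hJ _ in f fP.
pose C a : quo hQ := quo_pi hQ (a%:MP_[n] : P).
have Clin : linear C.
  move=> c u v; rewrite /C -linearP /=; congr (quo_pi _ _).
  by rewrite rmorphD -[c *: u]mulr_algl rmorphM.
have Cmon : monoid_morphism C.
  split; first by rewrite /C !rmorph1.
  by move=> u v; rewrite /C -rmorphM /= [in LHS]rmorphM.
pose G1 := GRing.isLinear.Build _ _ _ _ C Clin.
pose G2 := GRing.isMonoidMorphism.Build _ _ C Cmon.
pose Cl : {lrmorphism L -> quo hQ} := HB.pack C G1 G2.
have [|pibar pibarE'] := quo_factor hQ (f := pi); first by move=> p /asboolP[].
have pibarE p : pibar (quo_pi hQ p) = pi p by exact: pibarE'.
have pibarK t : pibar (tens_lift Cl f t) = t.
  elim/tensor_indP: t => [a h|t u IHt IHu]; last first.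
    transitivity (pibar (tens_lift Cl f t) + pibar (tens_lift Cl f u)).
      by rewrite !rmorphD.
    by rewrite IHt IHu.
  transitivity (inl a * inr h); last by rewrite /tens_inl /tens_inr tmulM mul1r mulr1.
  rewrite tens_lift_tmul rmorphM; congr (_ * _).
    exact: etrans (pibarE _) (piC a).
  by have [p pE] := quo_pi_surj (f h); rewrite -pE; apply: etrans (pibarE p) (fP h p _).
have [p pE] := quo_pi_surj (tens_lift Cl f z).
exists p; split; last by rewrite -[LHS]/(pi p) -pibarE pE pibarK.
have /eqP : quo_pi hQ (p ^+ m) = quo_pi hQ 0.
  by rewrite rmorphXn /= pE -rmorphXn zm0 !rmorph0.
move=> /eqP/quo_piP; rewrite subr0 => /asboolP[_ lp].
by apply: low_exp m0 _; apply: lowW lp.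
Qed.

End RationalPoint.

(** * Maximal ideals, prime ideals and nilpotent elements *)

Section Ideals.
Variable R : comNzRingType.

Lemma ideal_avoiding (I T : R -> Prop) :
  I 0 -> (forall a u v, I u -> I v -> I (a * u + v)) -> (forall v, I v -> ~ T v) ->
  T 1 ->
  exists M : {pred R}, [/\ idealr_closed M, forall v, I v -> v \in M,
    forall v, v \in M -> ~ T v
    & forall v, v \notin M -> exists c w, w \in M /\ T (c * v + w)].
Proof.
move=> I0 IM IT T1.
have [] := @maximal_submodule_avoiding R R^o I T => // W [[W0 WM] IW WT Wmax].
exists (fun v => `[< W v >]); split.
- split=> [||a u v /asboolP Wu /asboolP Wv]; apply/asboolP => //; last exact: WM.
  by move=> /WT.
- by move=> v /IW Wv; apply/asboolP.
- by move=> v /asboolP/WT.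
- by move=> v /asboolP/Wmax[c [w [Ww Tw]]]; exists c, w; split=> //; apply/asboolP.
Qed.

Lemma maximal_ideal (I : R -> Prop) :
  I 0 -> (forall a u v, I u -> I v -> I (a * u + v)) -> ~ I 1 ->
  exists M : {pred R}, [/\ idealr_closed M, forall v, I v -> v \in M
    & forall v, v \notin M -> exists c, c * v - 1 \in M].
Proof.
move=> I0 IM I1.
have [||M [hM IM' _ Mmax]] := @ideal_avoiding I (fun v => v = 1) I0 IM _ _ => //.
  by move=> v Iv v1; apply: I1; rewrite -v1.
exists M; split=> // v /Mmax[c [w [Mw e]]]; exists c; rewrite -e.
have [M0 _ MM] := hM.
by rewrite opprD addrA subrr add0r -mulN1r -[_ * w]addr0; apply: MM.
Qed.

(** An ideal maximal among those that contain no power of [x] is prime, yet it does not contain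
    [x]. *)
Lemma nilpotent_of_prime (x : R) :
  (forall P : {pred R}, prime_ideal P -> x \in P) -> exists m, x ^+ m = 0.
Proof.
move=> xP; apply: contrapT => /forallNP nx.
have [||||M [hM _ MT Mmax]] := @ideal_avoiding (fun v => v = 0) (fun v => exists m, v = x ^+ m).
- by [].
- by move=> a u v -> ->; rewrite mulr0 addr0.
- by move=> v -> [m /esym/nx].
- by exists 0%N.
have [M0 M1 MM] := hM.
have Ml a u : u \in M -> a * u \in M by move=> Mu; rewrite -[_ * _]addr0; apply: MM.
have MD u v : u \in M -> v \in M -> u + v \in M.
  by move=> Mu Mv; rewrite -[u]mul1r; apply: MM.
apply: (MT x); last by exists 1%N.
apply: xP; split=> // u v uv; apply: contraT; rewrite negb_or => /andP[/Mmax + /Mmax].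
move=> [a [w [Mw [m xm]]]] [b [w' [Mw' [m' xm']]]].
case: (MT (x ^+ (m + m'))); last by exists (m + m')%N.
rewrite exprD -xm -xm' mulrDl; apply: (MD); last by rewrite mulrC Ml.
by rewrite mulrDr; apply: (MD); [rewrite mulrACA Ml | rewrite Ml].
Qed.

End Ideals.

(** * Reducedness after base change to a field *)

Section Reduced.
Variables (k : fieldType) (F H : comAlgType k).
Hypotheses (hF : field_prop F) (fin : algebra_fin_gen H) (smooth : formally_smooth H).

Lemma contract_map (C : comAlgType k) (i : {lrmorphism F -> C})
    (f : {linear H -> k^o}) (z : tensor F H) :
  contract f (tens_map i idfun z) = i (contract f z).
Proof.
elim/tensor_indP: z => [a h|z t IHz IHt]; last by rewrite !raddfD /= IHz IHt.
by rewrite tens_map_tmul !contract_tmul linearZ.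
Qed.

Lemma base_change_reduced (x : tensor F H) m : x ^+ m = 0 -> x = 0.
Proof.
move=> xm0; apply: contrapT => x0.
pose Ann (y : tensor F H) := y * x = 0.
have [|||M [hM AnnM Mmax]] := @maximal_ideal _ Ann.
- exact: mul0r.
- by move=> a u v u0 v0; rewrite /Ann mulrDl -mulrA u0 v0 mulr0 addr0.
- by rewrite /Ann mul1r.
have hL : field_prop (quo hM).
  move=> y; have [a <-] := quo_pi_surj y => a0.
  have /Mmax[c ca] : a \notin M.
    apply/negP => aM; apply: a0; rewrite -(rmorph0 (quo_pi hM)).
    by apply/quo_piP; rewrite subr0.
  exists (quo_pi hM c); rewrite -rmorphM -(rmorph1 (quo_pi hM)).
  exact/quo_piP.
pose r : {lrmorphism tensor F H -> field_alg hL} := to_field_alg hL \o quo_pi hM.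
pose i : {lrmorphism F -> field_alg hL} := r \o @tens_inl k F H.
pose q : {lrmorphism H -> field_alg hL} := r \o @tens_inr k F H.
have [s gen] := fin.
pose j := tens_map i (@idfun H).
have jx : j x ^+ m = 0 by rewrite -rmorphXn xm0 rmorph0.
have [a [ea ax]] := nilpotent_krull q gen smooth jx.
pose e : {lrmorphism tensor (field_alg hL) H -> field_alg hL} := tens_lift idfun q.
have {}ea : e a = 0 by [].
(* On the image of [j] the point [e] is reduction modulo [M], so it kills the images of annihilators
   of [x]. *)
have ej z : e (j z) = r z.
  elim/tensor_indP: z => [b h|z t IHz IHt].
    have -> : j (tmul b h) = tmul (i b) h.
      exact: tens_map_tmul.
    rewrite [LHS]tens_lift_tmul.
    transitivity (r (tens_inl H b * tens_inr F h)); first by rewrite (rmorphM r).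
    congr (r _); by rewrite /tens_inl /tens_inr tmulM mulr1 mul1r.
  transitivity (e (j z) + e (j t)); first by rewrite !rmorphD.
  by rewrite IHz IHt; apply/esym/rmorphD.
have rep z : exists n (l : 'I_n -> field_alg hL) (y : 'I_n -> tensor F H),
    z = \sum_(u < n) tens_inl H (l u) * j (y u).
  have [n [l [h ->]]] := tensor_sum z; exists n, l, (fun u => tens_inr F (h u)).
  apply: eq_bigr => u _; rewrite [j _]tens_map_tmul rmorph1.
  by rewrite /tens_inl /tens_inr tmulM mulr1 mul1r.
(* A dependency between the coefficients [l u] shortens the expression; without
   one, all [y u] annihilate [x]. *)
have e_ann n (l : 'I_n -> field_alg hL) (y : 'I_n -> tensor F H) :
    (\sum_(u < n) tens_inl H (l u) * j (y u)) * j x = 0 ->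
    e (\sum_(u < n) tens_inl H (l u) * j (y u)) = 0.
  elim: n => [|n IHn] in l y *; first by rewrite big_ord0 rmorph0.
  move=> yx0; have [Ay|/existsNP[u yu]] := pselect (forall u, y u * x = 0).
    rewrite rmorph_sum big1// => u _.
    rewrite rmorphM; apply/eqP; rewrite mulf_eq0; apply/orP; right; apply/eqP.
    rewrite [LHS]ej; have /AnnM yM := Ay u.
    by rewrite -(rmorph0 r); apply/quo_piP; rewrite subr0.
  (* Contracting the relation [yx0] with [f] gives a linear relation between the [l v] with
     coefficients from [F], in which that of [l u] is invertible. *)
  have [f /eqP fy] : exists f : {linear H -> k^o}, contract f (y u * x) <> 0.
    by apply/existsNP => f0; apply: yu; apply: contract_inj.
  pose c v := contract f (y v * x).
  have [d dc] := hF (elimN eqP fy).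
  have clc v : contract f (tens_inl H (l v) * j (y v) * j x) = l v * i (c v).
    by rewrite -mulrA contractM /c -contract_map -rmorphM.
  have lc : \sum_(v < n.+1) l v * i (c v) = 0.
    rewrite -[RHS](raddf0 (contract f)) -yx0 mulr_suml raddf_sum.
    by apply: eq_bigr => v _; rewrite -clc.
  pose b v := - (d * c v).
  have ib v : i (b v) = - (i (c v) * i d) by rewrite -rmorphM -rmorphN mulrC.
  have lu : l u = \sum_(v < n) l (lift u v) * i (b (lift u v)).
    move: lc; rewrite (bigD1_ord u)//= => /eqP; rewrite addr_eq0 => /eqP lc.
    rewrite -[l u]mulr1 -(rmorph1 i) -dc rmorphM [i d * _]mulrC mulrA [l u * _]lc.
    rewrite mulNr mulr_suml -sumrN; apply: eq_bigr => v _.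
    by rewrite [X in _ = _ * X]ib mulrN mulrA.
  have sumE : \sum_(v < n.+1) tens_inl H (l v) * j (y v) =
     \sum_(v < n) tens_inl H (l (lift u v)) *
        j (y (lift u v) + tens_inl H (b (lift u v)) * y u).
    rewrite (bigD1_ord u)//= {1}lu [tens_inl H (\sum_(v < n) _)]rmorph_sum mulr_suml.
    rewrite -big_split; apply: eq_bigr => v _ /=.
    rewrite addrC rmorphD mulrDr; congr (_ + _).
    rewrite [in RHS]rmorphM mulrA [tens_inl H (_ * _)]rmorphM; congr (_ * _ * _).
    by rewrite [RHS]tens_map_tmul rmorph1.
  by rewrite sumE; apply: IHn; rewrite -sumE.
have [n [l [y aE]]] := rep (1 - a).
have e1a : e (1 - a) = 0.
  by rewrite aE; apply: e_ann; rewrite -aE mulrBl mul1r -ax subrr.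
have : e (1 - a) + e a = 1 by rewrite -(rmorphD e) subrK; apply: rmorph1.
by rewrite e1a ea addr0 => /esym/eqP; rewrite oner_eq0.
Qed.

End Reduced.

(** * Density of rational points *)

Lemma domain_mulfI (R : comNzRingType) (a b c : R) :
  is_domain R -> a <> 0 -> a * b = a * c -> b = c.
Proof.
move=> domR a0 abc; have /domR[//|/eqP] : a * (b - c) = 0 by rewrite mulrBr abc subrr.
by rewrite subr_eq0 => /eqP.
Qed.

(** * The integral closure of [k] in a domain is a field *)

Section Domain.
Variables (k : fieldType) (S : comAlgType k).
Hypothesis domS : is_domain S.

(** Induction on the size of the integral equation. A zero constant term allows cancelling [s]; a
    nonzero one, [c], makes [- c] a multiple of [s] by a polynomial in [s]. *)
Lemma integral_inverse (s : S) : s \in @is_integral k S -> s <> 0 ->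
  exists2 t, t \in @is_integral k S & t * s = 1.
Proof.
move=> sI s0; have /asboolP[p pmon /eqP ps] := sI.
have [m] := ubnP (size p); elim: m => // m IHm in p pmon ps *; rewrite ltnS => pm.
move: pmon ps pm; elim/poly_ind: p => [|p c _]; first by rewrite monicE lead_coef0 eq_sym oner_eq0.
move=> pmon; rewrite rmorphD rmorphM /= map_polyX map_polyC hornerD hornerMX hornerC => ps pm.
have [c0|c0] := eqVneq c 0.
  move: pmon ps pm; rewrite c0 polyC0 [X in _ + X = 0](rmorph0 (in_alg S)) !addr0 => pmon ps pm.
  have p0 : p != 0 by apply: contraTneq pmon => ->; rewrite mul0r monicE lead_coef0 eq_sym oner_eq0.
  have /domS[ps0|//] := ps.
  apply: (IHm p) => //; first by rewrite -(monicMr p (monicX k)).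
  by move: pm; rewrite size_mulX.
exists (- c^-1 *: (map_poly (in_alg S) p).[s]).
  rewrite horner_coef rpredZ//; apply: rpred_sum => i _.
  by rewrite coef_map rpredM ?rpredX// rpredZ// rpred1.
move/eqP: ps; rewrite addr_eq0 => /eqP ps.
by rewrite -scalerAl ps scaleNr scalerN opprK /= scalerA mulVf// scale1r.
Qed.

Local Notation K := (integral_closure S).

Definition closure_incl : K -> S := val.
Fact closure_incl_linear : linear closure_incl. Proof. by []. Qed.
Fact closure_incl_monoid : monoid_morphism closure_incl. Proof. by []. Qed.
HB.instance Definition _ :=
  GRing.isLinear.Build k K S *:%R closure_incl closure_incl_linear.
HB.instance Definition _ :=
  GRing.isMonoidMorphism.Build K S closure_incl closure_incl_monoid.

Lemma closure_field : field_prop K.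
Proof.
move=> c c0; have [||t tI tc] := @integral_inverse (val c).
- by case: c {c0}.
- by move=> v0; apply: c0; apply: val_inj.
by exists (IntegralClosure tI); apply: val_inj.
Qed.

Lemma closure_incl_inj (c d : K) : closure_incl c = closure_incl d -> c = d.
Proof. exact: val_inj. Qed.

Lemma tens_inl_inj0 (H : comAlgType k) (a : S) (z : tensor S H) :
  a <> 0 -> tens_inl H a * z = 0 -> z = 0.
Proof.
move=> a0 az; apply: contract_inj => f.
by apply: (domain_mulfI domS a0); rewrite -contractM az raddf0 mulr0.
Qed.

Lemma tens_inl_mulfI (H : comAlgType k) (a : S) (z t : tensor S H) :
  a <> 0 -> tens_inl H a * z = tens_inl H a * t -> z = t.
Proof.
move=> a0 azt; apply/eqP; rewrite -subr_eq0; apply/eqP.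
by apply: (tens_inl_inj0 a0); rewrite mulrBr azt subrr.
Qed.

Lemma tens_map_incl_inj (H : comAlgType k) (z t : tensor K H) :
  tens_map closure_incl idfun z = tens_map closure_incl idfun t -> z = t.
Proof.
move=> zt; apply/eqP; rewrite -subr_eq0; apply/eqP; apply: contract_inj => f.
apply: closure_incl_inj; rewrite -contract_map !raddfB /= zt.
by rewrite subrr [RHS]raddf0.
Qed.

End Domain.

Section Density.
Variables (k : fieldType) (G : affine_group k) (S : comAlgType k).
Hypotheses (smooth : smooth_algebraic_group G) (domS : is_domain S).
Local Notation K := (integral_closure S).
Hypothesis dense : points_dense G K.
Local Notation iK := (@closure_incl k S).

(** Density puts [x] into every prime ideal, so [x] is nilpotent, hence zero by reducedness. *)
Lemma vanishing_on_points (x : tensor K G) :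
  (forall g : points G K, tens_lift idfun g x = 0) -> x = 0.
Proof.
move=> gx; have [|m] := @nilpotent_of_prime _ x.
  pose E : {pred tensor K G} := fun x => `[< forall g : points G K, tens_lift idfun g x = 0 >].
  move=> P primeP; apply: (dense (E := E)) => //; last exact/asboolP.
  by move=> g y /asboolP/(_ g).
exact: base_change_reduced (closure_field domS) smooth.1 smooth.2 _ _.
Qed.

Definition ev (g : points G K) : {lrmorphism tensor S G -> S} := tens_lift idfun (iK \o g).

Lemma ev_tmul g a h : ev g (tmul a h) = a * iK (g h).
Proof. exact: tens_lift_tmul. Qed.

Variable V : S -> Prop.
Hypothesis VD : forall u v, V u -> V v -> V (u + v).
Hypothesis VZ : forall c u, V u -> V (u * iK c).

(** The image of [V (x) k[G]], written with explicit sums because the subspace [V] is a mere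
    predicate. *)
Definition tens_sub (z : tensor S G) : Prop :=
  exists2 s : seq (S * G), forall p, p \in s -> V p.1 & z = \sum_(p <- s) tmul p.1 p.2.

Lemma tens_subD z t : tens_sub z -> tens_sub t -> tens_sub (z + t).
Proof.
move=> [s sV ->] [r rV ->]; exists (s ++ r); last by rewrite big_cat.
by move=> p; rewrite mem_cat => /orP[/sV|/rV].
Qed.

Lemma tens_sub_mul v y : V v -> tens_sub (tens_inl G v * tens_map iK idfun y).
Proof.
move=> Vv; elim/tensor_indP: y => [c h|y t hy ht].
  exists [:: (v * iK c, h)]; first by move=> p; rewrite inE => /eqP ->; apply: VZ.
  by rewrite big_seq1 tens_map_tmul /tens_inl tmulM mul1r.
by rewrite rmorphD mulrDr; apply: tens_subD.
Qed.

Let VN v : V v -> V (- v).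
Proof. by move=> Vv; rewrite -[v]mulr1 -mulrN -(rmorph1 iK) -rmorphN; apply: VZ. Qed.

(* Write [z] with as few terms as possible modulo [V (x) k[G]]: if some [y u] does
   not vanish at a point [g], the value at [g] eliminates [s u]. *)
Lemma tens_sub_of_points z : (forall g, V (ev g z)) -> tens_sub z.
Proof.
(* Elimination produces coefficients in [K (x) k[G]] and a remainder in [tens_sub], so the induction
   is stated with both. *)
suff sub n (s : 'I_n -> S) (y : 'I_n -> tensor K G) z' : tens_sub z' ->
    (forall g, V (\sum_(i < n) s i * iK (tens_lift idfun g (y i)))) ->
    tens_sub (\sum_(i < n) tens_inl G (s i) * tens_map iK idfun (y i) + z').
  move=> zV; have [n [a [h zE]]] := tensor_sum z.
  have zE' : z = \sum_(i < n) tens_inl G (a i) * tens_map iK idfun (tens_inr K (h i)) + 0.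
    rewrite addr0 zE; apply: eq_bigr => i _.
    by rewrite [tens_map _ _ _]tens_map_tmul rmorph1 tens_inlMinr.
  rewrite zE'; apply: sub => [|g]; first by exists [::]; rewrite ?big_nil.
  rewrite (_ : \sum_(i < n) _ = ev g z)//.
  rewrite zE raddf_sum; apply: eq_bigr => i _.
  by rewrite [RHS]ev_tmul; congr (_ * iK _); rewrite [LHS]tens_lift_tmul mul1r.
elim: n => [|n IHn] in s y z' *; first by rewrite big_ord0 add0r.
move=> z'V sV.
have [y0|/existsNP[u yu]] := pselect (forall u, y u = 0).
  by rewrite big1 ?add0r// => i _; rewrite y0 rmorph0 mulr0.
have [g /eqP gy] : exists g : points G K, tens_lift idfun g (y u) <> 0.
  by apply/existsNP => gy; apply: yu; apply: vanishing_on_points.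
have [d dy] := closure_field domS (elimN eqP gy).
pose c v := tens_lift idfun g (y v).
pose b v := - (d * c v).
(* The value of the sum at [g], divided by that of [y u]: an element of [V] modulo which [s u] is a
   combination of the other [s i]. *)
pose v0 := (\sum_(i < n.+1) s i * iK (c i)) * iK d.
have Vv0 : V v0 by apply/VZ/sV.
have dcu : iK (c u) * iK d = 1 by rewrite -rmorphM mulrC [d * _]dy rmorph1.
have ib v : iK (b v) = - (iK (c v) * iK d) by rewrite -rmorphM -rmorphN mulrC.
have su : s u = v0 + \sum_(v < n) s (lift u v) * iK (b (lift u v)).
  rewrite /v0 (bigD1_ord u)//= mulrDl -mulrA dcu mulr1 mulr_suml -addrA -big_split.
  by rewrite big1 ?addr0// => i _ /=; rewrite ib mulrN mulrA subrr.
have sE : \sum_(v < n.+1) tens_inl G (s v) * tens_map iK idfun (y v) =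
   \sum_(v < n) tens_inl G (s (lift u v)) *
      tens_map iK idfun (y (lift u v) + tens_inl G (b (lift u v)) * y u)
   + tens_inl G v0 * tens_map iK idfun (y u).
  rewrite (bigD1_ord u)//= {1}su rmorphD rmorph_sum mulrDl mulr_suml.
  rewrite addrC addrCA addrC -big_split; congr (_ + _); apply: eq_bigr => v _ /=.
  rewrite [in RHS]rmorphD mulrDr; congr (_ + _).
  rewrite [in RHS]rmorphM mulrA [tens_inl G (_ * _)]rmorphM; congr (_ * _ * _).
  by rewrite [RHS]tens_map_tmul rmorph1.
rewrite sE -addrA; apply: IHn; first by apply: tens_subD => //; apply: tens_sub_mul.
(* At any point [g'] the shortened sum differs from the old one by [v0] times a scalar, thus by an
   element of [V]. *)
move=> g'; have := VD (sV g') (VN (VZ (tens_lift idfun g' (y u)) Vv0)).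
rewrite (_ : _ - _ = \sum_(i < n) s (lift u i) *
  iK (tens_lift idfun g' (y (lift u i) + tens_inl G (b (lift u i)) * y u)))//.
rewrite (bigD1_ord u)//= {1}su mulrDl addrAC [v0 * _ + _]addrC addrK mulr_suml.
rewrite -big_split; apply: eq_bigr => v _ /=.
rewrite addrC [in RHS]rmorphD [in RHS]rmorphD mulrDr; congr (_ + _).
rewrite -mulrA; congr (_ * _); rewrite -rmorphM; congr iK.
rewrite [RHS]rmorphM; congr (_ * _).
by rewrite [RHS]tens_lift_tmul rmorph1 mulr1.
Qed.

End Density.

(** * Elements algebraic over the integral closure *)

Section Algebraicity.
Variables (k : fieldType) (S : comAlgType k).
Hypothesis domS : is_domain S.
Local Notation K := (integral_closure S).
Local Notation iK := (@closure_incl k S).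

Lemma integral_over_closure (u : S) (p : {poly K}) :
  p \is monic -> root (map_poly iK p) u -> u \in @is_integral k S.
Proof.
move=> pmon pu; apply/asboolP.
apply: (@integral_root_monic _ _ _ _ (map_poly iK p)) => //.
  exact: monic_map.
move=> c /(nthP 0)[i _ <-]; rewrite coef_map /=.
by have /asboolP := valP (p`_i).
Qed.

(** The coordinates of [r.+1] powers of [u] form a matrix of rank at most [r]; a row in its left
    kernel is a polynomial equation for [u], made monic over the field [K]. *)
Lemma integral_of_powers (u : S) r (s : 'I_r -> S) :
  u <> 0 ->
  (forall n, exists c : 'I_r -> K, u ^+ n.+1 = \sum_(i < r) s i * iK (c i)) ->
  u \in @is_integral k S.
Proof.
move=> u0 uP; pose F := field_alg (closure_field domS).
pose c n := sval (cid (uP n)).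
have cE n : u ^+ n.+1 = \sum_(i < r) s i * iK (c n i) by rewrite /c; case: cid.
pose M : 'M[F]_(r.+1, r) := \matrix_(i, j) (c i j : F).
have [v v0 vM] : exists2 v : 'rV[F]_r.+1, v != 0 & v *m M = 0.
  have ker0 : kermx M != 0.
    rewrite -mxrank_eq0 mxrank_ker subn_eq0 -ltnNge ltnS; exact: rank_leq_col.
  by have [i ri] := rowV0Pn ker0; exists i => //; apply/sub_kermxP.
pose a i : K := if insub i is Some j then v 0 j else 0.
have aE (j : 'I_r.+1) : a j = v 0 j by rewrite /a valK.
pose p : {poly K} := \poly_(i < r.+1) a i.
have p0 : p != 0.
  apply: contraNneq v0 => p0; apply/eqP/rowP => j; rewrite mxE -aE.
  by have := congr1 (fun q : {poly K} => q`_j) p0; rewrite coef_poly ltn_ord coef0.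
have pu : (map_poly iK p).[u] = 0.
  (* The powers in [uP] start at exponent 1, so the relation first appears multiplied by [u]. *)
  apply: (domain_mulfI domS u0); rewrite mulr0 map_polyE.
  have -> : Poly [seq iK i | i <- p] = \poly_(i < r.+1) iK (a i).
    rewrite -map_polyE; apply/polyP => i; rewrite coef_map !coef_poly.
    by case: ifP => // _; rewrite rmorph0.
  rewrite horner_poly mulr_sumr.
  under eq_bigr => i _ do rewrite mulrCA -exprS cE mulr_sumr.
  rewrite exchange_big big1//= => j _.
  have := congr1 (fun q : 'rV[F]_r => q 0 j) vM; rewrite !mxE => vMj.
  transitivity (s j * iK (\sum_i (v 0 i : K) * c i j)).
    rewrite rmorph_sum mulr_sumr; apply: eq_bigr => i _.
    by rewrite aE rmorphM mulrCA.
  rewrite (_ : \sum_i _ = 0) ?rmorph0 ?mulr0//.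
  by rewrite -[RHS]vMj; apply: eq_bigr => i _; rewrite mxE.
have [d dl] : is_unit (lead_coef p).
  by apply: closure_field => //; apply/eqP; rewrite lead_coef_eq0.
have pd : lead_coef (d *: p) = 1.
  have dp : (d *: p)`_(size p).-1 = 1 by rewrite coefZ.
  rewrite lead_coefE (_ : size (d *: p) = size p)//; apply/eqP.
  rewrite eqn_leq size_scale_leq; have p_gt0 : (0 < size p)%N by rewrite lt0n size_poly_eq0.
  rewrite -(prednK p_gt0); apply: contraT; rewrite -leqNgt => /leq_sizeP/(_ _ (leqnn _)).
  by move=> /eqP; rewrite dp oner_eq0.
apply: (@integral_over_closure u (d *: p)); first by rewrite monicE pd.
by rewrite /root map_polyZ hornerZ pu mulr0.
Qed.

End Algebraicity.

(** * The action of [G(K)] on [S] *)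

Section Action.
Variables (k : fieldType) (G : affine_group k) (S : comAlgType k) (w : coaction G S).
Local Notation K := (integral_closure S).
Local Notation iK := (@closure_incl k S).
Hypothesis fixK : forall c : K, w (iK c) = tmul (iK c) 1.

Definition act (g : points G K) : {lrmorphism S -> S} := ev g \o w.

Definition point_inv (R : comAlgType k) (g : points G R) : points G R := g \o antipode G.

Lemma act_fixed g s : w s = tmul s 1 -> act g s = s.
Proof. by move=> ws; rewrite /act /= ws [LHS]ev_tmul rmorph1 [iK 1]rmorph1 mulr1. Qed.

(** [Phi] evaluates both sides of coassociativity at the pair [g], [h]. The scalars [iK (h x)] may
    be moved inside [act g] because it fixes [K]. *)
Lemma act_point_mul g h s : act (point_mul g h) s = act g (act h s).
Proof.
pose Phi : {lrmorphism tensor S (tensor G G) -> S} :=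
  tens_lift idfun (tens_lift (iK \o g) (iK \o h)).
transitivity (Phi (tens_map idfun (comul G) (w s))).
  apply: (tensor_ext (f := ev (point_mul g h)) (f' := Phi \o tens_map idfun (comul G))).
  move=> a x; rewrite [LHS]ev_tmul; transitivity (Phi (tmul a (comul G x))); last first.
    by congr (Phi _); apply/esym; apply: tens_map_tmul.
  rewrite [RHS]tens_lift_tmul; congr (_ * _).
  apply: (tensor_ext (f := iK \o tens_lift g h) (f' := tens_lift (iK \o g) (iK \o h))).
  move=> b c; rewrite [RHS]tens_lift_tmul; transitivity (iK (g b * h c)).
    by congr (iK _); apply: tens_lift_tmul.
  exact: (rmorphM iK).
transitivity (Phi (tens_assoc _ _ _ (tens_map w idfun (w s)))); first by rewrite coactA.
apply: (tensor_ext (f := Phi \o (@tens_assoc k S G G \o tens_map w idfun))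
  (f' := act g \o ev h)) => a x.
transitivity (Phi (tens_assoc S G G (tmul (w a) x))).
  by congr (Phi (tens_assoc _ _ _ _)); apply: tens_map_tmul.
transitivity (act g (a * iK (h x))); last by congr (act g _); apply/esym/ev_tmul.
rewrite rmorphM; transitivity (ev g (w a) * iK (h x)); last first.
  by congr (_ * _); apply/esym/act_fixed.
transitivity (Phi (tens_assoc S G G (tens_inl G (w a))) * iK (h x)).
  rewrite -tens_inlMinr !rmorphM; congr (_ * _).
  transitivity (Phi (tens_inr S (tens_inr G x))).
    by congr (Phi _); rewrite [LHS]tens_lift_tmul rmorph1 mul1r.
  rewrite [LHS]tens_lift_tmul mul1r [LHS]tens_lift_tmul.
  by rewrite rmorph1 mul1r.
congr (_ * _).
apply: (tensor_ext (f := Phi \o (@tens_assoc k S G G \o @tens_inl k (tensor S G) G))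
  (f' := ev g)) => b y.
rewrite [RHS]ev_tmul; transitivity (Phi (tmul b (tmul y 1))).
  congr (Phi _); rewrite [LHS]tens_lift_tmul rmorph1 mulr1 [LHS]tens_lift_tmul.
  by rewrite [LHS]tens_inlMinr.
rewrite [LHS]tens_lift_tmul; congr (_ * _).
by rewrite [LHS]tens_lift_tmul rmorph1 mulr1.
Qed.

(** Contraction with the identity of [k] identifies [A (x) k] with [A], which turns [coact1] into
    [contract_coact]. *)
Lemma counit_map (A : comAlgType k) (z : tensor A G) :
  contract (@idfun k^o : {linear k^o -> k^o}) (tens_map idfun (counit G) z)
  = contract (counit G) z.
Proof.
apply: (tensor_ext (f := contract (@idfun k^o : {linear k^o -> k^o}) \o tens_map idfun (counit G))
   (f' := contract (counit G))) => a h.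
transitivity (contract (@idfun k^o : {linear k^o -> k^o}) (tmul a (counit G h))).
  by congr (contract _ _); apply: tens_map_tmul.
by rewrite [LHS]contract_tmul [RHS]contract_tmul.
Qed.

Lemma contract_coact s : contract (counit G) (w s) = s.
Proof. by rewrite -counit_map coact1 contract_tmul scale1r. Qed.

(** The antipode axiom [comulVr] says that [g] times its inverse is the counit point. *)
Lemma lift_point_inv (A R : comAlgType k) (j : {lrmorphism A -> R}) (g : points G R) z :
  tens_lift j (point_mul g (point_inv g)) z = j (contract (counit G) z).
Proof.
apply: (tensor_ext (f := tens_lift j (point_mul g (point_inv g)))
  (f' := j \o contract (counit G))) => a h.
transitivity (j (counit G h *: a)); last by congr (j _); apply/esym/contract_tmul.
rewrite [LHS]tens_lift_tmul linearZ mulrC -[RHS]mulr_algl.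
congr (_ * _); transitivity (g (tens_lift idfun (antipode G) (comul G h))).
  apply: (tensor_ext (f := tens_lift g (point_inv g))
    (f' := g \o tens_lift idfun (antipode G))) => b c.
  rewrite [LHS]tens_lift_tmul; transitivity (g (b * antipode G c)); first by rewrite rmorphM.
  by congr (g _); apply/esym; apply: tens_lift_tmul.
by rewrite comulVr linearZ /= rmorph1.
Qed.

Lemma act_inv g s : act (point_mul g (point_inv g)) s = s.
Proof.
rewrite -[RHS]contract_coact; apply: (tensor_ext (f := ev (point_mul g (point_inv g)))
  (f' := contract (counit G))) => a h.
rewrite [LHS]ev_tmul [RHS]contract_tmul.
have := lift_point_inv (@idfun K) g (tmul 1 h).
rewrite tens_lift_tmul mul1r contract_tmul => ->.
by rewrite linearZ /= rmorph1 mulr_algr.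
Qed.

Lemma act_invK g s : act g (act (point_inv g) s) = s.
Proof. by rewrite -act_point_mul act_inv. Qed.

(** [act_invK] for [point_inv g] gives [act (point_inv g)] a right inverse, which must then agree
    with [act g]. *)
Lemma act_Kinv g s : act (point_inv g) (act g s) = s.
Proof.
by rewrite -{1}[s](act_invK (point_inv g)) act_invK act_invK.
Qed.

End Action.

(** * Semi-invariants *)

Definition divides (R : comNzRingType) (a b : R) : Prop := exists c, b = c * a.

Section SemiInvariant.
Variables (k : fieldType) (G : affine_group k) (S : comAlgType k) (w : coaction G S).
Local Notation K := (integral_closure S).
Local Notation iK := (@closure_incl k S).
Hypotheses (smooth : smooth_algebraic_group G) (domS : is_domain S).
Hypotheses (dense : points_dense G K) (triv : trivial_characters G K).
Hypothesis unitS : forall s : S, is_unit s -> s \in is_invariant w.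

Lemma coact_unit s : is_unit s -> w s = tmul s 1.
Proof. by move=> /unitS/eqP. Qed.

(** A nonzero element of the field [K] is a unit of [S], hence invariant. *)
Lemma coact_closure (c : K) : w (iK c) = tmul (iK c) 1.
Proof.
have [->|/eqP c0] := eqVneq c 0; first by rewrite !rmorph0 tmul0l.
have [d dc] := closure_field domS c0.
by apply: coact_unit; exists (iK d); rewrite -rmorphM dc rmorph1.
Qed.

(** * Group-like elements of [K (x) k[G]] as characters *)

Section Grouplike.
Variable chi : tensor K G.
Hypothesis chiM :
  tens_map idfun (comul G) chi
  = tens_map idfun (@tens_inl k G G) chi * tens_map idfun (@tens_inr k G G) chi.
Hypothesis chi1 : contract (counit G) chi = 1.

Let val (R : comAlgType k) (j : {lrmorphism K -> R}) (g : points G R) : R :=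
  tens_lift j g chi.

Let valM R j (g h : points G R) : val j (point_mul g h) = val j g * val j h.
Proof.
pose Phi : {lrmorphism tensor K (tensor G G) -> R} := tens_lift j (tens_lift g h).
transitivity (Phi (tens_map idfun (comul G) chi)).
  apply: (tensor_ext (f := tens_lift j (point_mul g h))
    (f' := Phi \o tens_map idfun (comul G))) => a x.
  rewrite [LHS]tens_lift_tmul; transitivity (Phi (tmul a (comul G x))); last first.
    by congr (Phi _); apply/esym; apply: tens_map_tmul.
  by rewrite [RHS]tens_lift_tmul.
rewrite chiM rmorphM; congr (_ * _).
  apply: (tensor_ext (f := Phi \o tens_map idfun (@tens_inl k G G)) (f' := tens_lift j g)).
  move=> a x; rewrite [RHS]tens_lift_tmul; transitivity (Phi (tmul a (tens_inl G x))).
    by congr (Phi _); apply: tens_map_tmul.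
  by rewrite [LHS]tens_lift_tmul; congr (_ * _); rewrite [LHS]tens_lift_tmul rmorph1 mulr1.
apply: (tensor_ext (f := Phi \o tens_map idfun (@tens_inr k G G)) (f' := tens_lift j h)).
move=> a x; rewrite [RHS]tens_lift_tmul; transitivity (Phi (tmul a (tens_inr G x))).
  by congr (Phi _); apply: tens_map_tmul.
by rewrite [LHS]tens_lift_tmul; congr (_ * _); rewrite [LHS]tens_lift_tmul rmorph1 mul1r.
Qed.

Let val_unit R j (g : points G R) : is_unit (val j g).
Proof.
exists (val j (point_inv g)).
by rewrite mulrC -valM [LHS]lift_point_inv chi1 rmorph1.
Qed.

Let val_nat (R R' : comAlgType k) (f : {lrmorphism R -> R'})
    (j : {lrmorphism K -> R}) (g : points G R) : val (f \o j) (f \o g) = f (val j g).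
Proof.
apply: (tensor_ext (f := tens_lift (f \o j) (f \o g)) (f' := f \o tens_lift j g)) => a h.
rewrite [LHS]tens_lift_tmul; transitivity (f (j a * g h)); first by rewrite (rmorphM f).
by congr (f _); apply/esym; apply: tens_lift_tmul.
Qed.

(** At the universal point, over [R = K (x) k[G]], the character defined by [chi] has the value
    [chi] itself. *)
Lemma grouplike_trivial : chi = 1.
Proof.
pose X := Character val_unit valM val_nat.
have := triv X (@tens_inl k K G) (@tens_inr k K G); rewrite /= /val => <-.
apply/esym; apply: (tensor_ext (f := tens_lift (@tens_inl k K G) (@tens_inr k K G))
  (f' := idfun)) => a h.
by rewrite [LHS]tens_lift_tmul tens_inlMinr.
Qed.

End Grouplike.

Lemma semi_invariant f : f <> 0 ->
  (forall g, divides f (act w g f)) -> (forall g, divides (act w g f) f) ->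
  w f = tmul f 1.
Proof.
move=> f0 f_act act_f.
have fcancel (a b : S) : a * f = b * f -> a = b.
  by move=> ab; apply: (domain_mulfI domS f0); rewrite ![f * _]mulrC.
(* [z] is the later [chi], so far with coefficients in [S]. *)
have [z wf] : exists z, w f = tens_inl G f * z.
  have [|||s sV wfE] := @tens_sub_of_points _ _ _ smooth domS dense (divides f) _ _ (w f).
  - by move=> u v [a ->] [b ->]; exists (a + b); rewrite mulrDl.
  - by move=> c u [a ->]; exists (a * iK c); rewrite mulrAC.
  - exact: f_act.
  rewrite wfE; elim: s sV {wfE} => [|[a h] s IHs] sV.
    by exists 0; rewrite big_nil mulr0.
  have [|z zE] := IHs; first by move=> p ps; apply: sV; rewrite inE ps orbT.
  have [c /= ->] := sV (a, h) (mem_head _ _).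
  exists (tmul c h + z); rewrite big_cons zE mulrDr; congr (_ + _).
  by rewrite /tens_inl tmulM mul1r mulrC.
pose X g := ev g z.
have Xf g : act w g f = X g * f.
  transitivity (ev g (tens_inl G f * z)); first by rewrite -wf.
  rewrite rmorphM mulrC; congr (_ * _); transitivity (f * iK (g 1)); first exact: ev_tmul.
  by rewrite !rmorph1 mulr1.
have Xunit g : is_unit (X g).
  have [d fE] := act_f g; exists d; apply: fcancel.
  by rewrite -mulrA -Xf mul1r -fE.
(* The values of [X] are units, hence invariant; the cocycle rule thus becomes multiplicativity. *)
have XM g h : X (point_mul g h) = X g * X h.
  apply: fcancel; rewrite -Xf act_point_mul ?Xf; last exact: coact_closure.
  transitivity (act w g (X h) * act w g f); first exact: rmorphM.
  by rewrite Xf mulrA (act_fixed g (coact_unit (Xunit h))) [X h * _]mulrC.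
(* Powers of a value are again values, and all values lie in the [K]-span of the finitely many
   [S]-components of [z]. *)
have Xpow g n : exists h, X g ^+ n.+1 = X h.
  elim: n => [|n [h hE]]; first by exists g; rewrite expr1.
  by exists (point_mul g h); rewrite exprS hE XM.
have XK g : exists c, X g = iK c.
  suff XI : X g \in @is_integral k S by exists (IntegralClosure XI).
  have [n [a [h zE]]] := tensor_sum z.
  apply: (integral_of_powers (r := n) (s := a) domS).
    by move=> X0; have [d] := Xunit g; rewrite X0 mulr0 => /esym/eqP; rewrite oner_eq0.
  move=> m; have [g' ->] := Xpow g m; exists (fun i => g' (h i)).
  rewrite /X zE raddf_sum; apply: eq_bigr => i _; exact: ev_tmul.
have [chi zE] : exists chi, z = tens_map iK idfun chi.
  have [|||s sV ->] := @tens_sub_of_points _ _ _ smooth domS dense (fun u => exists c, u = iK c) _ _ z.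
  - by move=> u v [a ->] [b ->]; exists (a + b); rewrite rmorphD.
  - by move=> c u [a ->]; exists (a * c); rewrite rmorphM.
  - exact: XK.
  elim: s sV => [|[a h] s IHs] sV; first by exists 0; rewrite big_nil rmorph0.
  have [|chi chiE] := IHs; first by move=> p ps; apply: sV; rewrite inE ps orbT.
  have [c /= ->] := sV (a, h) (mem_head _ _).
  exists (tmul c h + chi); rewrite big_cons chiE rmorphD; congr (_ + _).
  by apply/esym; apply: tens_map_tmul.
have chi1 : contract (counit G) chi = 1.
  apply: closure_incl_inj; apply: (domain_mulfI domS f0).
  rewrite -contract_map -zE -contractM -wf contract_coact.
  by rewrite rmorph1 mulr1.
(* Coassociativity applied to [w f = f chi], after cancelling [f]; the coefficients of [chi] in [K]
   are fixed by [w], so the second factor is a mere copy of [chi]. *)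
have chiM : tens_map idfun (comul G) chi
  = tens_map idfun (@tens_inl k G G) chi * tens_map idfun (@tens_inr k G G) chi.
  apply: tens_map_incl_inj; apply: (tens_inl_mulfI domS f0).
  transitivity (tens_map idfun (comul G) (w f)).
    rewrite wf zE rmorphM; congr (_ * _).
      by rewrite [RHS]tens_map_tmul rmorph1.
    apply: (tensor_ext (f := tens_map iK idfun \o tens_map idfun (comul G))
      (f' := tens_map idfun (comul G) \o tens_map iK idfun)) => a x.
    transitivity (tmul (iK a) (comul G x)).
      transitivity (tens_map iK (@idfun (tensor G G)) (tmul a (comul G x))).
        by congr (tens_map _ _ _); apply: tens_map_tmul.
      exact: tens_map_tmul.
    transitivity (tens_map idfun (comul G) (tmul (iK a) x)); last first.
      by congr (tens_map _ _ _); apply/esym; apply: tens_map_tmul.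
    by apply/esym; apply: tens_map_tmul.
  rewrite -coactA rmorphM mulrA.
  transitivity (tens_assoc S G G (tens_inl G (w f)) *
    tens_assoc S G G (tens_map w idfun (tens_map iK idfun chi))).
    rewrite -zE -rmorphM; congr (tens_assoc _ _ _ _).
    transitivity (tens_map w idfun (tens_inl G f * z)); first by rewrite -wf.
    rewrite rmorphM; congr (_ * _).
    by rewrite [LHS]tens_map_tmul.
  congr (_ * _).
    transitivity (tens_assoc S G G (tens_inl G (tens_inl G f)) *
      tens_assoc S G G (tens_inl G (tens_map iK idfun chi))).
      by rewrite wf zE -!rmorphM.
    congr (_ * _).
      by rewrite [LHS]tens_lift_tmul rmorph1 mulr1 [LHS]tens_lift_tmul rmorph1 mulr1.
    apply: (tensor_ext
      (f := @tens_assoc k S G G \o (@tens_inl k (tensor S G) G \o tens_map iK idfun))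
      (f' := tens_map iK idfun \o tens_map idfun (@tens_inl k G G))) => a x.
    transitivity (tmul (iK a) (tens_inl G x)); last first.
      transitivity (tens_map iK (@idfun (tensor G G)) (tmul a (tens_inl G x))).
        by apply/esym; apply: tens_map_tmul.
      by congr (tens_map _ _ _); apply/esym; apply: tens_map_tmul.
    transitivity (tens_assoc S G G (tens_inl G (tmul (iK a) x))).
      by congr (tens_assoc _ _ _ (tens_inl _ _)); apply: tens_map_tmul.
    rewrite [LHS]tens_lift_tmul rmorph1 mulr1 [LHS]tens_lift_tmul.
    by rewrite [LHS]tens_inlMinr.
  apply: (tensor_ext
    (f := @tens_assoc k S G G \o (tens_map w idfun \o tens_map iK idfun))
    (f' := tens_map iK idfun \o tens_map idfun (@tens_inr k G G))) => a x.
  transitivity (tmul (iK a) (tens_inr G x)); last first.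
    transitivity (tens_map iK (@idfun (tensor G G)) (tmul a (tens_inr G x))).
      by apply/esym; apply: tens_map_tmul.
    by congr (tens_map _ _ _); apply/esym; apply: tens_map_tmul.
  transitivity (tens_assoc S G G (tmul (tmul (iK a) 1) x)).
    congr (tens_assoc _ _ _ _); rewrite -coact_closure.
    transitivity (tens_map w idfun (tmul (iK a) x)).
      by congr (tens_map _ _ _); apply: tens_map_tmul.
    exact: tens_map_tmul.
  rewrite [LHS]tens_lift_tmul [X in X * _]tens_lift_tmul.
  by rewrite !rmorph1 mulr1 [LHS]tens_inlMinr.
by rewrite wf zE (grouplike_trivial chiM chi1) rmorph1 mulr1.
Qed.

End SemiInvariant.

(** * Factorization *)

Section Factorization.
Variable R : comNzRingType.
Hypothesis domR : is_domain R.
Implicit Types (x y p a b : R) (s t : seq R).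

Definition prime_elt p : Prop :=
  [/\ p <> 0, ~ is_unit p
    & forall a b, divides p (a * b) -> divides p a \/ divides p b].

Lemma divides_refl p : divides p p. Proof. by exists 1; rewrite mul1r. Qed.

Lemma divides_trans p a b : divides p a -> divides a b -> divides p b.
Proof. by move=> [c ->] [d ->]; exists (d * c); rewrite mulrA. Qed.

Lemma divides_mull p a b : divides p b -> divides p (a * b).
Proof. by move=> [c ->]; exists (a * c); rewrite mulrA. Qed.

Lemma divides_mulr p a b : divides p a -> divides p (a * b).
Proof. by rewrite mulrC; apply: divides_mull. Qed.

Lemma divides_unit p a : divides p a -> is_unit a -> is_unit p.
Proof. by move=> [c ->] [d dcp]; exists (d * c); rewrite -mulrA. Qed.

Lemma is_unitM a b : is_unit a -> is_unit b -> is_unit (a * b).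
Proof. by move=> [c ca] [d db]; exists (c * d); rewrite mulrACA ca db mulr1. Qed.

Lemma divides_prod p s : p \in s -> divides p (\prod_(x <- s) x).
Proof.
move=> ps; rewrite (perm_big _ (perm_to_rem ps)) big_cons /= mulrC.
exact: divides_mull (divides_refl p).
Qed.

Lemma prime_divides_prod p s : prime_elt p -> divides p (\prod_(x <- s) x) ->
  exists2 x, x \in s & divides p x.
Proof.
move=> [p0 pu pP]; elim: s => [|x s IHs]; rewrite ?big_nil ?big_cons.
  by move=> p1; case: pu; apply: (divides_unit p1); exists 1; rewrite mulr1.
move=> /pP[px|/IHs[y ys py]]; first by exists x; rewrite ?mem_head.
by exists y; rewrite // inE ys orbT.
Qed.

Lemma prime_irreducible p : prime_elt p -> irreducible p.
Proof.
move=> [p0 pu pP]; split=> // x y pxy.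
have [[c xE]|[c yE]] : divides p x \/ divides p y.
- by apply: pP; rewrite -pxy; apply: divides_refl.
- right; exists c; apply: (domain_mulfI domR p0).
  by rewrite mulr1 [RHS]pxy [in RHS]xE; ring.
- left; exists c; apply: (domain_mulfI domR p0).
  by rewrite mulr1 [RHS]pxy [in RHS]yE; ring.
Qed.

Lemma irreducible_divides p x : irreducible x -> ~ is_unit p -> divides p x ->
  exists2 c, is_unit c & x = c * p.
Proof. by move=> [_ _ xP] pu [c xE]; exists c => //; case: (xP _ _ xE). Qed.

Lemma irreducible_notin_unit s u : is_unit u ->
  (forall p, p \in s -> irreducible p) -> divides (\prod_(x <- s) x) u -> s = [::].
Proof.
case: s => // p s uu sirr; rewrite big_cons => psu.
have [_ pu _] := sirr p (mem_head _ _); case: pu; apply: divides_unit uu.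
by apply: divides_trans psu; apply: divides_mulr; apply: divides_refl.
Qed.

(** The cofactor [c] covers divisibility as well as equality of products; the unit [u] collects the
    discrepancies during induction. *)
Lemma prime_prod_cancel p t s c u :
  is_unit u -> prime_elt p -> (forall q, q \in s -> irreducible q) ->
  c * \prod_(q <- p :: t) q = u * \prod_(q <- s) q ->
  exists y, exists2 d, is_unit d &
    [/\ y \in s, y = d * p & c * \prod_(q <- t) q = (u * d) * \prod_(q <- rem y s) q].
Proof.
move=> uu pp sirr; rewrite big_cons => e; have [p0 pu pP] := pp.
have [y ys py] : exists2 y, y \in s & divides p y.
  apply: (prime_divides_prod pp); have [|pu'|//] := pP u (\prod_(q <- s) q).
    by exists (c * \prod_(q <- t) q); rewrite -e mulrCA mulrC.
  by case: pu; apply: divides_unit pu' uu.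
have [d du yE] := irreducible_divides (sirr y ys) pu py.
exists y, d => //; split=> //; apply: (domain_mulfI domR p0).
transitivity (c * (p * \prod_(q <- t) q)); first by ring.
by rewrite e (perm_big _ (perm_to_rem ys)) big_cons /= {1}yE; ring.
Qed.

Lemma size_prime_prod t s c u :
  is_unit u -> (forall q, q \in t -> prime_elt q) ->
  (forall q, q \in s -> irreducible q) ->
  c * \prod_(q <- t) q = u * \prod_(q <- s) q -> (size t <= size s)%N.
Proof.
elim: t s u => // p t IHt s u uu tp sirr e.
have [y [d du [ys _ e']]] := prime_prod_cancel uu (tp p (mem_head _ _)) sirr e.
have s0 : (0 < size s)%N by case: (s) ys.
rewrite -(prednK s0) /= ltnS -(size_rem ys); apply: IHt e'; first exact: is_unitM.
  by move=> q qt; apply: tp; rewrite inE qt orbT.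
by move=> q /mem_rem/sirr.
Qed.

Lemma prime_factorization_unique s t u :
  is_unit u -> (forall q, q \in s -> prime_elt q) ->
  (forall q, q \in t -> irreducible q) ->
  \prod_(q <- s) q = u * \prod_(q <- t) q ->
  exists t', [/\ perm_eq t t', size s = size t'
    & forall i, (i < size s)%N -> associated s`_i t'`_i].
Proof.
elim: s t u => [|p s IHs] t u uu sp tirr e.
  have -> : t = [::]; last by exists [::].
  apply: (@irreducible_notin_unit t 1) => //; first by exists 1; rewrite mulr1.
  by exists u; rewrite -e big_nil.
have e1 : 1 * \prod_(q <- p :: s) q = u * \prod_(q <- t) q by rewrite mul1r.
have [y [d du [yt yE e']]] := prime_prod_cancel uu (sp p (mem_head _ _)) tirr e1.
rewrite mul1r in e'; have [|||t' [tt' st' at']] := IHs _ _ _ _ _ e'.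
- exact: is_unitM.
- by move=> q qs; apply: sp; rewrite inE qs orbT.
- by move=> q /mem_rem/tirr.
exists (y :: t'); split; last by case=> [_|i /at'//]; exists d.
  by apply: perm_trans (perm_to_rem yt) _; rewrite perm_cons.
by rewrite /= st'.
Qed.

(** An irreducible element is associated to a prime factor of itself, hence prime, and
    factorizations into primes are unique. *)
Lemma ufd_of_prime_factorization :
  (forall x, x <> 0 -> ~ is_unit x ->
    exists2 s, forall p, p \in s -> prime_elt p & x = \prod_(p <- s) p) ->
  is_ufd R.
Proof.
move=> fact.
have irr_prime p : irreducible p -> prime_elt p.
  move=> [p0 pu pP]; have [[|q s] sp pE] := fact p p0 pu.
    by case: pu; rewrite pE big_nil; exists 1; rewrite mulr1.
  have [q0 qu qP] := sp q (mem_head _ _).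
  have [d du e] : exists2 d, is_unit d & p = d * q.
    apply: irreducible_divides => //; rewrite pE big_cons.
    by apply: divides_mulr; apply: divides_refl.
  split=> // a b pab; have [d' d'd] := du.
  have qE : q = d' * p by rewrite e mulrA d'd mul1r.
  have pq x : divides q x -> divides p x.
    by apply: divides_trans; rewrite qE; apply: divides_mull; apply: divides_refl.
  have [|/pq|/pq] := qP a b; [|by left|by right].
  by apply: divides_trans pab; rewrite e; apply: divides_mull; apply: divides_refl.
split=> // [x x0 xu|s t sirr tirr e].
  by have [s sp ->] := fact x x0 xu; exists s => // p /sp/prime_irreducible.
apply: (@prime_factorization_unique _ _ 1) => //; first by exists 1; rewrite mulr1.
  by move=> p /sirr/irr_prime.
by rewrite mul1r.
Qed.

Lemma irreducible_unitM u p : is_unit u -> irreducible p -> irreducible (u * p).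
Proof.
move=> [v vu] [p0 pu pP].
have pE : p = v * (u * p) by rewrite mulrA vu mul1r.
split=> [up0|upu|x y upE]; first by apply: p0; rewrite pE up0 mulr0.
  by apply: pu; apply: divides_unit upu; apply: divides_mull (divides_refl p).
have [|vx|] := pP (v * x) y; first by rewrite -mulrA -upE.
  by left; apply: divides_unit vx; apply: divides_mull (divides_refl x).
by right.
Qed.

Lemma ufd_factor x : is_ufd R -> x <> 0 -> exists u s,
  [/\ is_unit u, forall p, p \in s -> irreducible p & x = u * \prod_(p <- s) p].
Proof.
move=> [_ fact _] x0; have [xu|nxu] := pselect (is_unit x).
  by exists x, [::]; split=> //; rewrite big_nil mulr1.
have [s sirr xE] := fact x x0 nxu; exists 1, s; split=> //; last by rewrite mul1r.
by exists 1; rewrite mulr1.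
Qed.

Lemma ufd_irreducible_prime p : is_ufd R -> irreducible p -> prime_elt p.
Proof.
move=> [_ fact uniq] pirr; have [p0 pu pP] := pirr; split=> // a b [c abc].
have [-> |/eqP a0] := eqVneq a 0; first by left; exists 0; rewrite mul0r.
have [-> |/eqP b0] := eqVneq b 0; first by right; exists 0; rewrite mul0r.
have c0 : c <> 0.
  by move=> c0; move: abc; rewrite c0 mul0r => /domR[].
have ufdR : is_ufd R by split.
have [ua [s [[va vua] sirr aE]]] := ufd_factor ufdR a0.
have [ub [t [[vb vub] tirr bE]]] := ufd_factor ufdR b0.
have [uc [r [ucu rirr cE]]] := ufd_factor ufdR c0.
(* Uniqueness in [is_ufd] compares bare products, so all units are absorbed into [p]; this factor is
   listed first and has its associate at index 0. *)
have p'irr : irreducible (va * vb * uc * p).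
  apply: irreducible_unitM => //; apply: is_unitM => //; apply: is_unitM.
    by exists ua; rewrite mulrC.
  by exists ub; rewrite mulrC.
have [||| t' [stt' szt']] := uniq (va * vb * uc * p :: r) (s ++ t).
- by move=> q; rewrite inE => /orP[/eqP->|/rirr].
- by move=> q; rewrite mem_cat => /orP[/sirr|/tirr].
- rewrite big_cons big_cat /=.
  transitivity (va * vb * (c * p)); first by rewrite cE; ring.
  rewrite -abc aE bE; transitivity ((va * ua) * (vb * ub) * (\prod_(q <- s) q * \prod_(q <- t) q)).
    ring.
  by rewrite vua vub !mul1r.
move=> /(_ 0%N isT) /= [d _ pt'].
have t'0 : (0 < size t')%N by rewrite -szt'.
have : t'`_0 \in s ++ t by rewrite (perm_mem stt') mem_nth.
have pt0 : divides p t'`_0.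
  by rewrite pt'; do 2!apply: divides_mull; apply: divides_refl.
rewrite mem_cat => /orP[] /divides_prod/(divides_trans pt0) pd; [left|right].
  by rewrite aE; apply: divides_mull.
by rewrite bE; apply: divides_mull.
Qed.

(* For lists of primes this means pairwise non-associated. *)
Fixpoint nonassociated t : Prop :=
  if t is p :: t' then (forall q, q \in t' -> ~ divides p q) /\ nonassociated t'
  else True.

(** The head [p] divides [b], a multiple of the remaining product, but no other member of the list;
    being prime it divides the cofactor. *)
Lemma prod_primes_divides t b :
  (forall p, p \in t -> prime_elt p) -> nonassociated t ->
  (forall p, p \in t -> divides p b) -> divides (\prod_(p <- t) p) b.
Proof.
elim: t => [|p t IHt] tp tn tb; first by exists b; rewrite big_nil mulr1.
have [|||c bE] := IHt.
- by move=> q qt; apply: tp; rewrite inE qt orbT.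
- by case: tn.
- by move=> q qt; apply: tb; rewrite inE qt orbT.
have pp := tp p (mem_head _ _); have [p0 pu pP] := pp.
have [[d cE]|/(prime_divides_prod pp)[q qt pq]] : divides p c \/ divides p (\prod_(p <- t) p).
- by apply: pP; rewrite -bE; apply: tb; apply: mem_head.
- by exists d; rewrite bE cE big_cons mulrA.
- by have [/(_ q qt)] := tn.
Qed.

End Factorization.

(** * Prime factorization in the ring of invariants *)

Section InvariantFactorization.
Variables (k : fieldType) (G : affine_group k) (S : comAlgType k) (w : coaction G S).
Local Notation K := (integral_closure S).
Hypotheses (smooth : smooth_algebraic_group G) (ufdS : is_ufd S).
Hypotheses (dense : points_dense G K) (triv : trivial_characters G K).
Hypothesis unitS : forall s : S, is_unit s -> s \in is_invariant w.

Let domS : is_domain S. Proof. by case: ufdS. Qed.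
Let fixK := coact_closure domS unitS.


Lemma divides_act g p a : divides p a -> divides (act w g p) (act w g a).
Proof. by move=> [c ->]; exists (act w g c); rewrite rmorphM. Qed.

Lemma act_divides g p a : divides (act w g p) (act w g a) -> divides p a.
Proof.
by move=> /(divides_act (point_inv g)); rewrite !(act_Kinv fixK).
Qed.

Lemma act_prime g p : prime_elt p -> prime_elt (act w g p).
Proof.
move=> [p0 pu pP]; split.
- by move=> gp0; apply: p0; rewrite -(act_Kinv fixK g p) gp0 rmorph0.
- move=> [c cgp]; apply: pu; exists (act w (point_inv g) c).
  by rewrite -{1}(act_Kinv fixK g p) -rmorphM cgp rmorph1.
move=> a b.
have [aE bE] := (act_invK fixK g a, act_invK fixK g b).
move: aE bE; move: (act w (point_inv g) a) (act w (point_inv g) b) => x y <- <-; rewrite -rmorphM.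
by move=> /act_divides/pP[] pd; [left|right]; apply: divides_act.
Qed.

Section Orbit.
Variables (p a : S).
Hypotheses (pirr : irreducible p) (a0 : a <> 0) (wa : w a = tmul a 1) (pa : divides p a).

Let orb q := exists g, q = act w g p.
Let orbit_list t := (forall q, q \in t -> orb q) /\ nonassociated t.

Let orb_prime q : orb q -> prime_elt q.
Proof. by move=> [g ->]; apply/act_prime/ufd_irreducible_prime. Qed.

Let orb_divides q b : w b = tmul b 1 -> divides p b -> orb q -> divides q b.
Proof. by move=> wb pb [g ->]; rewrite -(act_fixed g wb); apply: divides_act. Qed.

Let orb_act q g : orb q -> orb (act w g q).
Proof. by move=> [h ->]; exists (point_mul g h); rewrite (act_point_mul fixK). Qed.

(** The counit provides a point [g] over [K], and [g] times its inverse acts trivially. *)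
Let orb_refl : orb p.
Proof.
pose u (x : G) : K := (counit G x : k) *: (1 : K).
have ulin : linear u by move=> c x y; rewrite /u linearP scalerDl scalerA.
have umon : monoid_morphism u.
  split=> [|x y]; first by rewrite /u rmorph1 scale1r.
  by rewrite /u rmorphM -scalerAl mul1r scalerA.
pose U1 := GRing.isLinear.Build _ _ _ _ u ulin.
pose U2 := GRing.isMonoidMorphism.Build _ _ u umon.
pose g : points G K := HB.pack u U1 U2.
by exists (point_mul g (point_inv g)); rewrite act_inv.
Qed.

(* The number of irreducible factors of [a] bounds the length of such lists. *)
Lemma maximal_orbit_list : exists2 t, orbit_list t & forall q, orb q -> divides q (\prod_(x <- t) x).
Proof.
have [u [s [uu sirr aE]]] := ufd_factor ufdS a0.
pose P n := `[< exists2 t, orbit_list t & size t = n >].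
have P0 : exists n, P n by exists 0%N; apply/asboolP; exists [::].
have Pub n : P n -> (n <= size s)%N.
  move=> /asboolP[t [torb tn] <-].
  have [||c ac] := @prod_primes_divides _ t a _ tn; [by move=> q /torb/orb_prime| |].
    by move=> q /torb; apply: orb_divides.
  apply: (@size_prime_prod _ domS t s c u) => //; first by move=> q /torb/orb_prime.
  by rewrite -ac.
case: (ex_maxnP P0 Pub) => n /asboolP[t tl tn] nmax; exists t => // q qorb.
apply: contrapT => nq; have : P n.+1.
  apply/asboolP; exists (q :: t); last by rewrite /= tn.
  have [torb tnon] := tl; split=> [x|]; first by rewrite inE => /orP[/eqP->|/torb].
  split=> // x xt qx; apply: nq; apply: divides_trans qx _; exact: divides_prod.
by move=> /nmax; rewrite ltnn.
Qed.

(** The product over a maximal list of pairwise non-associated members of the orbit is the least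
    common multiple of the orbit. *)
Lemma orbit_product : exists t, [/\ (0 < size t)%N, forall q, q \in t -> prime_elt q,
  divides p (\prod_(q <- t) q), w (\prod_(q <- t) q) = tmul (\prod_(q <- t) q) 1
  & forall b, w b = tmul b 1 -> divides p b -> divides (\prod_(q <- t) q) b].
Proof.
have [t [torb tnon] tmax] := maximal_orbit_list.
have tprime q : q \in t -> prime_elt q by move=> /torb/orb_prime.
exists t; split=> //.
- case: (t) (tmax p orb_refl) => //; rewrite big_nil => p1; have [_ pu _] := pirr.
  by case: pu; apply: divides_unit p1 _; exists 1; rewrite mulr1.
- exact: tmax.
(* The translated list still consists of non-associated primes from the orbit, each dividing the
   product by maximality. The opposite divisibility comes from the inverse of [g]. *)
- have act_prod g : divides (act w g (\prod_(q <- t) q)) (\prod_(q <- t) q).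
    have -> : act w g (\prod_(q <- t) q) = \prod_(q <- map (act w g) t) q.
      by rewrite big_map rmorph_prod.
    apply: prod_primes_divides.
    - by move=> q /mapP[x /tprime xp ->]; apply: act_prime.
    - elim: (t) tnon => //= x r IHr [xr rn]; split; last exact: IHr.
      by move=> q /mapP[y yr ->] /act_divides; apply: xr.
    - by move=> q /mapP[x /torb xo ->]; apply/tmax/orb_act.
  apply: (semi_invariant smooth domS dense triv unitS) => // [|g].
    elim: (t) tprime => [|x r IHr] rp; first by rewrite big_nil; apply/eqP; rewrite oner_eq0.
    rewrite big_cons => /domS[x0|]; first by have [] := rp x (mem_head _ _).
    by apply: IHr => q qr; apply: rp; rewrite inE qr orbT.
  rewrite -{1}(act_invK fixK g (\prod_(q <- t) q)); exact: divides_act.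
- move=> b wb pb; apply: prod_primes_divides => // q /torb.
  exact: orb_divides.
Qed.

End Orbit.

Local Notation A := (invariant_ring w).

Let coactA_val (a : A) : w (val a) = tmul (val a) 1.
Proof. by case: a => s /= /eqP. Qed.

Let A_unit (a : A) : is_unit (val a) -> is_unit a.
Proof.
move=> [d da]; have du : d \in is_invariant w by apply: unitS; exists (val a); rewrite mulrC.
by exists (InvariantRing du); apply: val_inj.
Qed.

(** Applying [w] to the quotient equation and cancelling [f] shows that the quotient is
    invariant. *)
Let A_divides (f b : A) : val f <> 0 -> divides (val f) (val b) -> divides f b.
Proof.
move=> f0 [c bE]; have cA : c \in is_invariant w.
  apply/eqP; apply: (tens_inl_mulfI domS f0).
  rewrite /tens_inl tmulM -coactA_val mulr1 [val f * _]mulrC -bE -coactA_val bE.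
  by rewrite rmorphM mulrC.
by exists (InvariantRing cA); apply: val_inj.
Qed.

(** If the orbit product [f] divides [x * y], then [p] divides one factor in [S], and being
    invariant that factor is divisible by [f]. The list [t] is returned for counting. *)
Lemma invariant_prime_divisor (a : A) : a <> 0 -> ~ is_unit a ->
  exists (t : seq S) (f b : A), [/\ (0 < size t)%N, forall q, q \in t -> prime_elt q,
    val f = \prod_(q <- t) q, prime_elt f & a = b * f].
Proof.
move=> a0 au.
have va0 : val a <> 0 by move=> va; apply: a0; apply: val_inj.
have [u [[|p s] [uu sirr aE]]] := ufd_factor ufdS va0.
  by case: au; apply: A_unit; rewrite aE big_nil mulr1.
have pirr := sirr p (mem_head _ _).
have pa : divides p (val a).
  by rewrite aE big_cons; apply/divides_mull/divides_mulr/divides_refl.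
have [t [t0 tp pt wt tdiv]] := orbit_product pirr va0 (coactA_val a) pa.
have fA : \prod_(q <- t) q \in is_invariant w by apply/eqP.
pose f := InvariantRing fA.
have [c aE'] := tdiv _ (coactA_val a) pa.
have f0 : val f <> 0 by move=> /= f0; apply: va0; rewrite aE' f0 mulr0.
have [b ab] : divides f a by apply: A_divides => //; exists c.
exists t, f, b; split=> //; split.
- by move=> e; apply: f0; rewrite e.
- move=> [d df]; have [_ + _] := pirr; apply.
  by apply: divides_unit pt _; exists (val d); rewrite -[LHS]/(val (d * f)) df.
move=> x y [d xy]; have [_ _ pP] := ufd_irreducible_prime domS ufdS pirr.
have [px|py] : divides p (val x) \/ divides p (val y).
- apply: pP; rewrite -[val x * val y]/(val (x * y)) xy.
  by apply: divides_mull.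
- by left; apply: A_divides => //; apply: tdiv.
- by right; apply: A_divides => //; apply: tdiv.
Qed.

Lemma invariant_ring_ufd : is_ufd A.
Proof.
have domA : is_domain A.
  move=> x y xy; have /domS[] : val x * val y = 0 by rewrite -[LHS]/(val (x * y)) xy.
    by move=> x0; left; apply: val_inj.
  by move=> y0; right; apply: val_inj.
apply: ufd_of_prime_factorization => // a a0 au.
have va0 : val a <> 0 by move=> va; apply: a0; apply: val_inj.
have [u [s [uu sirr aE]]] := ufd_factor ufdS va0.
(* Induction on the number of irreducible factors of [val a] in [S]; each [f] uses up at least
   one. *)
have [n] := ubnP (size s); elim: n => // n IHn in a u s a0 au va0 uu sirr aE *.
rewrite ltnS => sn.
have [t [f [b [t0 tp fE fp ab]]]] := invariant_prime_divisor a0 au.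
have b0 : b <> 0 by move=> b0; apply: a0; rewrite ab b0 mul0r.
have [bu|bu] := pselect (is_unit b).
  (* A list of primes has no room for the unit [b], so [a = b * f] itself is taken as the prime. *)
  exists [:: a]; last by rewrite big_seq1.
  move=> q; rewrite inE => /eqP ->; rewrite ab.
  have [f0 fu fP] := fp; have [c cb] := bu; split.
  - by move=> /domA[].
  - by move=> [d dbf]; apply: fu; exists (d * b); rewrite -mulrA.
  move=> x y [d xy]; have cbf z : divides f z -> divides (b * f) z.
    by move=> [e ->]; exists (e * c); rewrite mulrA -(mulrA e) cb mulr1.
  have [||] := fP x y; first by exists (d * b); rewrite xy mulrA.
    by left; apply: cbf.
  by right; apply: cbf.
have vb0 : val b <> 0 by move=> vb; apply: b0; apply: val_inj.
have [u' [s' [uu' s'irr bE]]] := ufd_factor ufdS vb0.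
have le_s : (size (t ++ s') <= size s)%N.
  have [v vu'] := uu'.
  apply: (@size_prime_prod _ domS (t ++ s') s u' u) => //.
    move=> q; rewrite mem_cat => /orP[/tp//|/s'irr].
    exact: ufd_irreducible_prime.
  by rewrite -aE ab /= fE bE big_cat /=; ring.
have [|r rp bE'] := IHn b u' s' b0 bu vb0 uu' s'irr bE.
  by apply: leq_trans sn; apply: leq_trans le_s; rewrite size_cat -[X in (X < _)%N]add0n ltn_add2r.
exists (f :: r); last by rewrite big_cons ab bE' mulrC.
by move=> q; rewrite inE => /orP[/eqP->|/rp].
Qed.

End InvariantFactorization.

Theorem lemma4p29 (k : fieldType) (G : affine_group k) (S : comAlgType k)
    (w : coaction G S) :
  smooth_algebraic_group G ->
  is_ufd S ->
  points_dense G (integral_closure S) ->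
  trivial_characters G (integral_closure S) ->
  (forall s : S, is_unit s -> s \in is_invariant w) ->
  is_ufd (invariant_ring w).
Proof.
move=> smooth ufdS dense triv unitS.
exact: invariant_ring_ufd smooth ufdS dense triv unitS.
Qed.
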